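(* Let $0<T\le\infty$, $0<m<\infty$, $\Omega=(0,T)\times(0,m)$, and let $G:\mathbb R^4\to\mathbb R$ be continuous and satisfy (A0) and (A1) of the context. Let $u^\pm:\Omega\cup\partial_p\Omega\to\mathbb R$ be locally bounded, $x$-monotonic functions such that $u^-$ is a subsolution and $u^+$ a supersolution of $G(u,\partial_tu,\partial_xu,\partial_x^2u)=0$ in $\Omega$, satisfying (B1) $u^-\le u^+$ in $\Omega\cup\partial_p\Omega$; (B2) $(u^-)_*=(u^+)^*$ on $\partial_p\Omega$. Then there exists a unique $x$-monotonic viscosity solution $u\in C(\Omega\cup\partial_p\Omega)$ of $G(u,\partial_tu,\partial_xu,\partial_x^2u)=0$ in $\Omega$ with the property that $u=u^-(=u^+)$ on $\partial_p\Omega$. This solution satisfies $u^-\le u\le u^+$. The assertion remains valid when dropping the $x$-monotonicity everywhere.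
   Context: (A0) $q\mapsto G(z,\alpha,p,q)$ is non-increasing for all $z,\alpha,p\in\mathbb R$. (A1) For all $p,q$ the function $(z,\alpha)\mapsto G(z,\alpha,p,q)$ is weakly strictly increasing: for all $(z,\alpha),(z',\alpha')\in\mathbb R^2$, $z\le z'$ and $\alpha\le\alpha'$ imply $G(z,\alpha,p,q)\le G(z',\alpha',p,q)$; and $z<z'$ and $\alpha<\alpha'$ imply $G(z,\alpha,p,q)<G(z',\alpha',p,q)$. Parabolic boundary: $\partial_p\Omega=\partial\Omega\setminus(\{T\}\times[0,m])$. $u=u(t,x)$ is $x$-monotonic if $x\mapsto u(t,x)$ is non-decreasing for every $t$. Semicontinuous envelopes: $u^*(\omega)=\lim_{r\searrow0}\sup\{u(\xi):|\xi-\omega|\le r\}$, $u_*(\omega)=\lim_{r\searrow0}\inf\{u(\xi):|\xi-\omega|\le r\}$, where $\xi$ ranges over the domain of $u$ (here $\Omega\cup\partial_p\Omega$ for $u^\pm$). Viscosity solutions: a test function is a function that is $C^1$ in $t$ and $C^2$ in $x$. For $\omega\in\Omega$, $\mathcal P^+u(\omega)$ (resp. $\mathcal P^-u(\omega)$) is the set of triples $(\partial_t\phi,\partial_x\phi,\partial_x^2\phi)(\omega)$ where $\phi$ is a test function with $\phi(\omega)=u(\omega)$ and $\phi\ge u$ (resp. $\phi\le u$) near $\omega$. $u$ is a subsolution in $\Omega$ if it is upper semicontinuous in $\Omega$ and $G(u(\omega),\alpha,p,q)\le0$ for all $\omega\in\Omega$, $(\alpha,p,q)\in\mathcal P^+u(\omega)$;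 a supersolution if it is lower semicontinuous in $\Omega$ and $G(u(\omega),\alpha,p,q)\ge0$ for all $\omega\in\Omega$, $(\alpha,p,q)\in\mathcal P^-u(\omega)$; a viscosity solution if it is both. *)

(* Defs.v *)
From mathcomp Require Import all_boot all_order all_algebra.
From mathcomp Require Import all_classical all_reals all_analysis.

Set Implicit Arguments.
Unset Strict Implicit.
Unset Printing Implicit Defensive.

Import Order.TTheory GRing.Theory Num.Theory.
Import numFieldNormedType.Exports.

Local Open Scope classical_set_scope.
Local Open Scope ring_scope.

(* Points of the plane are pairs (t, x).  A function on a set A of the plane is
   represented by a total function R * R -> R; every notion below depends only
   on its values on A. *)

Section Domain.
Context {R : realType}.
Implicit Types (T : \bar R) (m : R).

(* T = +oo is allowed *)
Definition Omega T m : set (R * R) :=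
  [set w | 0 < w.1 /\ (w.1%:E < T)%E /\ 0 < w.2 < m].

Definition topological_boundary (A : set (R * R)) : set (R * R) :=
  closure A `\` A°.

(* the removed set {T} x [0, m] is empty when T = +oo *)
Definition parabolic_boundary T m : set (R * R) :=
  topological_boundary (Omega T m) `\`
  [set w | w.1%:E = T /\ 0 <= w.2 <= m].

Definition Omega_bar T m : set (R * R) :=
  Omega T m `|` parabolic_boundary T m.

End Domain.

Section Functions.
Context {R : realType}.
Implicit Types (A : set (R * R)) (u phi : R * R -> R) (w : R * R).

Definition x_monotonic A u : Prop :=
  forall t x y, A (t, x) -> A (t, y) -> x <= y -> u (t, x) <= u (t, y).

(* The subspace topology gives semicontinuity of the restriction of u to A. *)
Definition lower_semicontinuous_on A u : Prop :=
  lower_semicontinuous (from_subspace A (fun w => (u w)%:E)).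

Definition upper_semicontinuous_on A u : Prop :=
  lower_semicontinuous_on A (fun w => - u w).

(* Values are extended reals; they are finite where u is locally bounded.
   The norm on R * R is the max norm, which gives the same limits as the
   Euclidean one. *)
Definition upper_envelope A u w : \bar R :=
  lim (ereal_sup [set (u xi)%:E | xi in [set xi | A xi /\ `|xi - w| <= r]]
         @[r --> 0^'+]).

Definition lower_envelope A u w : \bar R :=
  lim (ereal_inf [set (u xi)%:E | xi in [set xi | A xi /\ `|xi - w| <= r]]
         @[r --> 0^'+]).

Definition partial_t phi w : R := derive1 (fun t => phi (t, w.2)) w.1.
Definition partial_x phi w : R := derive1 (fun x => phi (w.1, x)) w.2.
Definition partial_xx phi w : R := partial_x (partial_x phi) w.

(* C^1 in t and C^2 in x: the derivatives exist at every point of the open set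
   A and are jointly continuous in (t, x). *)
Definition test_function A phi : Prop :=
  [/\ forall w, A w ->
        [/\ derivable (fun t => phi (t, w.2)) w.1 1,
            derivable (fun x => phi (w.1, x)) w.2 1 &
            derivable (fun x => partial_x phi (w.1, x)) w.2 1],
      {within A, continuous (partial_t phi)},
      {within A, continuous (partial_x phi)} &
      {within A, continuous (partial_xx phi)}].

Definition jet phi w : R * R * R :=
  (partial_t phi w, partial_x phi w, partial_xx phi w).

Definition superjet A u w : set (R * R * R) :=
  [set jet phi w | phi in [set phi | [/\ test_function A phi,
     phi w = u w & \forall xi \near w, u xi <= phi xi]]].

Definition subjet A u w : set (R * R * R) :=
  [set jet phi w | phi in [set phi | [/\ test_function A phi,
     phi w = u w & \forall xi \near w, phi xi <= u xi]]].

End Functions.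

Section Equation.
Context {R : realType}.
Implicit Types (G : R * R * R * R -> R) (A : set (R * R)) (u : R * R -> R).

(* G is applied to (z, alpha, p, q), standing for (u, u_t, u_x, u_xx). *)
Definition cond_A0 G : Prop :=
  forall z a p q q', q <= q' -> G (z, a, p, q') <= G (z, a, p, q).

Definition cond_A1 G : Prop :=
  forall p q z z' a a',
    (z <= z' -> a <= a' -> G (z, a, p, q) <= G (z', a', p, q)) /\
    (z < z' -> a < a' -> G (z, a, p, q) < G (z', a', p, q)).

(* In the three definitions below A is meant to be open. *)
Definition subsolution G A u : Prop :=
  upper_semicontinuous_on A u /\
  forall w, A w -> forall a p q,
    superjet A u w (a, p, q) -> G (u w, a, p, q) <= 0.

Definition supersolution G A u : Prop :=
  lower_semicontinuous_on A u /\
  forall w, A w -> forall a p q,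
    subjet A u w (a, p, q) -> 0 <= G (u w, a, p, q).

Definition viscosity_solution G A u : Prop :=
  subsolution G A u /\ supersolution G A u.

End Equation.

(* Main.v *)
Require Import Defs.
From mathcomp Require Import all_boot all_order all_algebra.
From mathcomp Require Import all_classical all_reals all_analysis.
From mathcomp Require Import ring lra.

Set Implicit Arguments.
Unset Strict Implicit.
Unset Printing Implicit Defensive.

Import Order.TTheory GRing.Theory Num.Theory.
Import numFieldNormedType.Exports.

Local Open Scope classical_set_scope.
Local Open Scope ring_scope.

(* Existence is Perron's method: the largest subsolution [u] between [um] and [up]
   equals its upper envelope, and a bump argument shows that its lower envelope is a
   supersolution; at the parabolic boundary both envelopes equal [um = up], so the
   comparison principle makes them coincide.  Uniqueness is comparison, and
   x-monotonicity follows by comparing [u] with its translate [u(t, x + h)] on the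
   narrower domain, where the boundary inequalities come from [um] and [up].

   Comparison: since [G] does not depend on [(t, x)], a translate of a subsolution is
   a subsolution.  After subtracting [a / (tau - t)] the two inequalities are strictly
   separated, and one doubles the variables.  The midpoint of the doubling maximum is
   a maximum of the difference of the sup- and inf-convolutions.  There both have
   parabolas above and below, so the derivatives at which they can be touched nearby
   stay close to the gradient at the maximum; hence no test function touches the
   sup-convolution with an x-second derivative below some [Q1], nor the
   inf-convolution with one above some [Q2 < Q1].  As no second time derivative
   occurs, this gives convexity in x at fixed t: the difference is strictly convex in
   x at its maximum, a contradiction.  In one space dimension this replaces
   Alexandrov's theorem. *)

(** (A1) is strict only when the value and the time derivative both increase strictly. This dictates
    the penalty [a / (tau - t)]: it and its derivative are both bounded below by positive constants,
    and it is as large as needed at the artificial final time.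

    At the doubling maximum the two functions have opposite slopes. With these frozen, the strict
    inequality reads [0 < H1 q + H2 (- q)] for every [q]: at each [q] at least one of the two
    equations forbids touching. A single [q] would give thresholds of sum zero and no contradiction;
    monotonicity of [H1] locates the value at which the prohibition changes sides, and continuity
    opens a gap there, so that the two thresholds have a positive sum.

    A semicontinuous [u] offers no control of its values near the contact point, whereas continuity
    of [H] needs them. Between contact points of the sup-convolution, however, the values of [u] are
    determined by the convolution and its slopes, both of which vary in a controlled way. *)

Lemma compact_usc_max (R : realType) (X : topologicalType) (K : set X)
    (F : X -> R) :
  compact K -> K !=set0 ->
  (forall x M, K x -> F x < M -> \forall y \near x, K y -> F y < M) ->
  exists2 c, K c & forall y, K y -> F y <= F c.
Proof.
move=> cK [x0 Kx0] uscF; apply: contrapT => nomax.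
have above x : K x -> exists2 y, K y & F x < F y.
  move=> Kx; apply: contrapT => noy; apply: nomax; exists x => // y Ky.
  by rewrite leNgt; apply/negP => xy; apply: noy; exists y.
(* The superlevel sets are nested, hence a filter base. A cluster point [c] is not a maximum, so
   [F c < F y] for some [y], and semicontinuity gives a neighbourhood of [c] that misses [B y]. *)
pose B := fun y => [set x | K x /\ F y <= F x].
pose FF := filter_from K B.
have filtFF : ProperFilter FF.
  apply: filter_from_proper; last by move=> y Ky; exists y; split.
  apply: filter_from_filter; first by exists x0.
  move=> i j Ki Kj; have [ij|/ltW ji] := leP (F i) (F j).
    by exists j => // x [Kx jx]; do 2!split => //; exact: le_trans jx.
  by exists i => // x [Kx ix]; do 2!split => //; exact: le_trans ix.
have [|c [Kc clc]] := cK FF filtFF; first by exists x0 => // x [].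
have [y Ky cy] := above c Kc.
have := uscF c (F y) Kc cy.
move=> /(clc _ _ _)-/(_ (B y)) [|x [[Kx yx] /(_ Kx)]]; first by exists y.
by rewrite ltNge yx.
Qed.

Lemma near_box (R : realType) (w : R * R) (P : R * R -> Prop) :
  (\forall xi \near w, P xi) <->
  exists2 r : R, 0 < r & forall xi,
    `|xi.1 - w.1| < r -> `|xi.2 - w.2| < r -> P xi.
Proof.
split=> [/nbhs_ballP[r /= r0 wr]|[r r0 wr]].
  exists r => // xi h1 h2; apply: wr; split;
    by rewrite -ball_normE /ball_/= distrC.
apply/nbhs_ballP; exists r => //= xi [].
by rewrite -!ball_normE /ball_/= => h1 h2; apply: wr; rewrite distrC.
Qed.

Lemma continuous4_pos (R : realType) (H : R * R * R * R -> R) z a p q :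
  {for (z, a, p, q), continuous H} -> 0 < H (z, a, p, q) ->
  exists2 d : R, 0 < d & forall z' a' p' q', `|z' - z| < d -> `|a' - a| < d ->
    `|p' - p| < d -> `|q' - q| < d -> 0 < H (z', a', p', q').
Proof.
move=> cH H0; have : \forall w \near (z, a, p, q), 0 < H w by exact: cvgr_gt cH _ H0.
move=> /nbhs_ballP[d /= d0 dH].
exists d => // z' a' p' q' hz ha hp hq.
by apply: dH; do 3?split; rewrite -ball_normE /ball_/= distrC.
Qed.

(** * Touching by quadratics and convexity in x *)

Section Quadratic.
Context {R : realType}.
Implicit Types (f u : R -> R -> R) (t x a b p q r h k A C : R).

(** The variables are separated. The coefficient [b] is at free disposal, since [G] does not see it;
    the factor one half makes [q] the second x-derivative. *)
Definition quadratic_above u t x a b p q r := forall k h, `|k| < r -> `|h| < r ->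
  u (t + k) (x + h) <= u t x + a * k + b * k ^+ 2 + p * h + q / 2 * h ^+ 2.

(* Testing with quadratics near a point, unlike with [superjet], does not involve the
   rest of [A]: it passes to smaller domains and to translates. *)
Definition quadratic_subsolution (G : R * R * R * R -> R) (A : R -> R -> Prop) u :=
  forall t x, A t x -> forall a b p q r, 0 < r ->
    quadratic_above u t x a b p q r -> G (u t x, a, p, q) <= 0.

Lemma compact_box (t0 t1 x0 x1 : R) :
  compact [set w : R * R | t0 <= w.1 <= t1 /\ x0 <= w.2 <= x1].
Proof.
have -> : [set w : R * R | t0 <= w.1 <= t1 /\ x0 <= w.2 <= x1] =
    `[t0, t1]%classic `*` `[x0, x1]%classic.
  by apply/seteqP; split => w /=; rewrite !in_itv.
by apply: compact_setX; exact: segment_compact.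
Qed.

(* A positive maximum of [f - parabola - b (t - t0)^2] over the box of radius [h]
   would, for [b] large, be interior and give a quadratic touching from above. *)
Lemma midconvex_of_no_touching f t0 x0 h A C :
  0 < h -> 0 <= C ->
  (forall t x t' x', `|t - t0| <= h -> `|x - x0| <= h ->
     `|t' - t0| <= h -> `|x' - x0| <= h ->
     f t x <= f t' x' + C * (`|t - t'| + `|x - x'|)) ->
  (forall t x a b p r, `|t - t0| < h -> `|x - x0| < h -> 0 < r ->
     ~ quadratic_above f t x a b p A r) ->
  f t0 x0 <= (f t0 (x0 + h) + f t0 (x0 - h)) / 2 - A / 2 * h ^+ 2.
Proof.
move=> h0 C0 lipf notouch; rewrite leNgt; apply/negP => gt0.
set m0 := (f t0 (x0 + h) + f t0 (x0 - h)) / 2 in gt0.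
pose m1 := (f t0 (x0 + h) - f t0 (x0 - h)) / (2 * h).
pose d := f t0 x0 - (m0 - A / 2 * h ^+ 2).
have d0 : 0 < d by rewrite subr_gt0.
(* The parabola with second derivative [A] through the values of [f t0] at [x0 - h] and [x0 + h];
   [d] is the excess of [f t0] over it at [x0]. *)
pose L x := m0 + m1 * (x - x0) + A / 2 * ((x - x0) ^+ 2 - h ^+ 2).
have Lp : L (x0 + h) = f t0 (x0 + h) by rewrite /L /m0 /m1; field; rewrite gt_eqF.
have Lm : L (x0 - h) = f t0 (x0 - h) by rewrite /L /m0 /m1; field; rewrite gt_eqF.
have L0 : f t0 x0 - L x0 = d by rewrite /L /d; ring.
pose S := `|m0| + `|m1| * h + `|A| * h ^+ 2 + `|f t0 x0| + 2 * C * h + 1.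
have S0 : 0 < S.
  have h2 : 0 <= `|A| * h ^+ 2 by apply: mulr_ge0 => //; apply: sqr_ge0.
  have : 0 <= `|m1| * h by rewrite mulr_ge0// ltW.
  have : 0 <= C * h by rewrite mulr_ge0// ltW.
  have := normr_ge0 m0; have := normr_ge0 (f t0 x0).
  rewrite /S; lra.
(* On the sides [|t - t0| = h] one has [f - L < S], beaten by [S / h ^+ 2]. On the sides
   [x = x0 - h] and [x = x0 + h], where [L] agrees with [f t0], one has [f - L <= C * s] with
   [s = |t - t0|], and [C ^+ 2 / d] gives [C * s - b * s ^+ 2 < d]. *)
pose b := S / h ^+ 2 + C ^+ 2 / d + 1.
have hh : 0 < h ^+ 2 by rewrite exprn_gt0.
have b0 : 0 < b.
  have : 0 < S / h ^+ 2 by rewrite divr_gt0.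
  have : 0 <= C ^+ 2 / d by rewrite divr_ge0 ?sqr_ge0// ltW.
  by rewrite /b; lra.
pose F (w : R * R) := f w.1 w.2 - L w.2 - b * (w.1 - t0) ^+ 2.
pose B := [set w : R * R | t0 - h <= w.1 <= t0 + h /\ x0 - h <= w.2 <= x0 + h].
have BP w : B w -> `|w.1 - t0| <= h /\ `|w.2 - x0| <= h.
  by move=> [/andP[? ?] /andP[? ?]]; rewrite !ler_norml; lra.
have contL : continuous (fun w : R * R => L w.2 + b * (w.1 - t0) ^+ 2).
  have c1 : continuous (fun w : R * R => w.1) by move=> ?; exact: cvg_fst.
  have c2 : continuous (fun w : R * R => w.2) by move=> ?; exact: cvg_snd.
  move=> w; apply: cvgD.
    apply: cvgD; first apply: cvgD; first exact: cvg_cst.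
      by apply: cvgM; [exact: cvg_cst|apply: cvgB; [exact: c2|exact: cvg_cst]].
    apply: cvgM; first exact: cvg_cst.
    apply: cvgB; last exact: cvg_cst.
    by apply: cvgM; apply: cvgB; by [exact: c2|exact: cvg_cst].
  apply: cvgM; first exact: cvg_cst.
  by apply: cvgM; apply: cvgB; by [exact: c1|exact: cvg_cst].
have [||[t x] Btx maxF] := @compact_usc_max R _ B F (@compact_box _ _ _ _).
- by exists (t0, x0); split => /=; lra.
- move=> w M Bw wM.
  pose e := (M - F w) / 2.
  have e0 : 0 < e by rewrite /e; lra.
  have C1 : 0 < C + 1 by lra.
  have near1 : \forall y \near w,
      L w.2 + b * (w.1 - t0) ^+ 2 - e < L y.2 + b * (y.1 - t0) ^+ 2.
    by apply: (cvgr_gt _ (contL w)); rewrite ltrBlDr ltrDl.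
  have near2 : \forall y \near w, `|y.1 - w.1| + `|y.2 - w.2| < e / (C + 1).
    apply/near_box; exists (e / (C + 1) / 2); first by apply: divr_gt0 => //; apply: divr_gt0.
    by move=> y y1 y2; rewrite [ltRHS]splitr ltrD.
  apply: filterS2 near1 near2 => y h1 h2 By.
  have [? ?] := BP _ By; have [? ?] := BP _ Bw.
  have h3 : C * (`|y.1 - w.1| + `|y.2 - w.2|) < e.
    have : (C + 1) * (`|y.1 - w.1| + `|y.2 - w.2|) < e.
      by rewrite mulrC -ltr_pdivlMr.
    have := normr_ge0 (y.1 - w.1); have := normr_ge0 (y.2 - w.2); lra.
  have : f y.1 y.2 <= f w.1 w.2 + C * (`|y.1 - w.1| + `|y.2 - w.2|) by exact: lipf.
  by rewrite /F; move: e0 h1 h3; rewrite /e /F; lra.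
have [/= tB xB] := BP _ Btx.
have Fd : d <= F (t, x).
  have -> : d = F (t0, x0) by rewrite /F /= subrr expr0n mulr0 subr0 L0.
  by apply: maxF; split => /=; lra.
have end_x y : `|y - x0| <= h -> L y = f t0 y -> x != y.
  move=> yB Ly; apply/eqP => xy; move: Fd; rewrite /F /= xy Ly.
  apply/negP; rewrite -ltNge.
  have lf : f t y <= f t0 y + C * `|t - t0|.
    have := lipf t y t0 y tB yB; rewrite !subrr !normr0 addr0; apply => //.
    exact: ltW.
  pose s := `|t - t0|; have -> : (t - t0) ^+ 2 = s ^+ 2.
    by rewrite real_normK// num_real.
  rewrite -/s in lf.
  have : C * s - b * s ^+ 2 < d; last by lra.
  have bd : C ^+ 2 / d < b.
    by rewrite /b; have := divr_gt0 S0 hh; lra.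
  rewrite ltr_pdivrMr// in bd.
  have : 0 < b * (d - C * s + b * s ^+ 2); last by rewrite pmulr_rgt0//; lra.
  have := sqr_ge0 (b * s - C / 2); have := sqr_ge0 C; nra.
have xp : x != x0 + h.
  by apply: end_x => //; rewrite (_ : _ - _ = h); [rewrite gtr0_norm|ring].
have xm : x != x0 - h.
  by apply: end_x => //; rewrite (_ : _ - _ = - h); [rewrite normrN gtr0_norm|ring].
have th : `|t - t0| != h.
  apply/eqP => teq; move: Fd; apply/negP; rewrite -ltNge; apply: (lt_trans _ d0).
  rewrite /F /=; have -> : (t - t0) ^+ 2 = h ^+ 2 by rewrite -teq real_normK// num_real.
  have : f t x <= f t0 x0 + C * (h + h).
    have := lipf t x t0 x0 tB xB; rewrite !subrr !normr0.
    move=> /(_ (ltW h0) (ltW h0)).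
    have := ler_wpM2l C0 tB; have := ler_wpM2l C0 xB; lra.
  have : - L x <= `|m0| + `|m1| * h + `|A| * h ^+ 2.
    have : - (m1 * (x - x0)) <= `|m1| * h.
      by rewrite (le_trans (ler_norm _))// normrN normrM ler_wpM2l.
    have : - (A / 2 * ((x - x0) ^+ 2 - h ^+ 2)) <= `|A| * h ^+ 2.
      rewrite (le_trans (ler_norm _))// normrN normrM ler_pM//.
        rewrite normrM [`|2^-1|]ger0_norm ?invr_ge0//; have := normr_ge0 A; lra.
      rewrite ler_norml; have := sqr_ge0 (x - x0).
      have : (x - x0) ^+ 2 <= h ^+ 2.
        by rewrite -[X in X <= _]real_normK ?num_real// lerXn2r ?nnegrE// ltW.
      lra.
    have := ler_norm (- m0); rewrite normrN /L; lra.
  have : S < b * h ^+ 2.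
    rewrite -ltr_pdivrMr// /b.
    have : 0 <= C ^+ 2 / d by rewrite divr_ge0 ?sqr_ge0// ltW.
    lra.
  have := ler_norm (f t0 x0); rewrite /S; lra.
have xlt : `|x - x0| < h.
  rewrite lt_neqAle xB andbT; apply/eqP => xe.
  have [xx|xx] := leP 0 (x - x0).
    by move: xe xp; rewrite ger0_norm// => <-; rewrite addrC subrK eqxx.
  by move: xe xm; rewrite ltr0_norm// => <-; rewrite opprK addrC subrK eqxx.
have tlt : `|t - t0| < h by rewrite lt_neqAle th tB.
pose r := Num.min (h - `|t - t0|) (h - `|x - x0|).
have r0 : 0 < r by rewrite lt_min !subr_gt0 tlt xlt.
(* The coefficients are those of [L x + b * (t - t0) ^+ 2] expanded about the maximum. *)
apply: (notouch t x (2 * b * (t - t0)) b (m1 + A * (x - x0)) r tlt xlt r0).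
move=> k l; rewrite !lt_min => /andP[k1 _] /andP[_ l2].
have : F (t + k, x + l) <= F (t, x).
  apply: maxF; split => /=.
    have := ler_normD (t - t0) k; rewrite (_ : t - t0 + k = t + k - t0); last by ring.
    move=> nk; have : `|t + k - t0| <= h by lra.
    by rewrite ler_norml; lra.
  have := ler_normD (x - x0) l; rewrite (_ : x - x0 + l = x + l - x0); last by ring.
  move=> nk; have : `|x + l - x0| <= h by lra.
  by rewrite ler_norml; lra.
rewrite /F /L /= => hF; rewrite -subr_ge0; rewrite -subr_ge0 in hF.
by apply: le_trans hF _; rewrite le_eqVlt; apply/orP; left; apply/eqP; field.
Qed.

End Quadratic.

(** * Sup-convolution in one space dimension *)

Section SupConvolution.
Context {R : realType}.
Implicit Types (t x a b p q r h k l C : R).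

(** Used with [c] the difference of two slopes: a function with a parabola below it at a point has
    the slope of any quadratic touching it there from above. *)
Lemma linear_le_quadratic_eq0 c D r : 0 < r ->
  (forall k, `|k| < r -> c * k <= D * k ^+ 2) -> c = 0.
Proof.
move=> r0 cD; apply/eqP/negPn/negP => c0.
pose M := `|D| + 1; have M0 : 0 < M by have := normr_ge0 D; rewrite /M; lra.
have nc : 0 < `|c| by rewrite normr_gt0.
pose j := Num.min (r / 2) (`|c| / (2 * M)).
have j0 : 0 < j by rewrite lt_min !divr_gt0// mulr_gt0.
have jr : j < r by rewrite gt_min; apply/orP; left; lra.
have jc : j * (2 * M) <= `|c|.
  by rewrite -ler_pdivlMr ?mulr_gt0// /j ge_min lexx orbT.
have := cD (Num.sg c * j); rewrite normrM normr_sg c0 mul1r gtr0_norm// => /(_ jr).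
rewrite mulrCA mulrA -normrEsg exprMn sqr_sg c0 mul1r expr2 mulrA ler_pM2r//.
have : D * j <= M * j by rewrite ler_pM2r// /M; have := ler_norm D; lra.
lra.
Qed.

Variables (K : R -> R -> Prop) (u : R -> R -> R) (e : R) (s1 s2 : R -> R -> R).
Hypothesis e0 : 0 < e.

(** The sup-convolution of [u] over [K], written through a chosen maximizer, the contact point
    [(s1 t x, s2 t x)]; [al] and [be] are the slopes that the penalty has there. *)
Let f t x := u (s1 t x) (s2 t x) - ((t - s1 t x) ^+ 2 + (x - s2 t x) ^+ 2) / (2 * e).
Hypothesis Ks : forall t x, K (s1 t x) (s2 t x).
Hypothesis maxs : forall t x a b, K a b ->
  u a b - ((t - a) ^+ 2 + (x - b) ^+ 2) / (2 * e) <= f t x.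
Let al t x := (s1 t x - t) / e.
Let be t x := (s2 t x - x) / e.

(** The contact point of [(t, x)] remains a competitor at [(t + k, x + l)]. *)
Lemma supconv_semiconvex t x k l :
  f t x + al t x * k + be t x * l - (k ^+ 2 + l ^+ 2) / (2 * e) <= f (t + k) (x + l).
Proof.
apply: le_trans (maxs (t + k) (x + l) (Ks t x)).
rewrite le_eqVlt /f /al /be; apply/orP; left; apply/eqP; field.
by rewrite gt_eqF.
Qed.

Variables (t0 x0 : R).
(** At a maximum of the sum of [f] and a second sup-convolution, the parabola below the latter
    becomes this parabola above [f]. *)
Hypothesis upper : forall k l, f (t0 + k) (x0 + l) <=
  f t0 x0 + al t0 x0 * k + be t0 x0 * l + (k ^+ 2 + l ^+ 2) / (2 * e).

(** The lower parabola at the nearby point, followed for one more step [h] in either direction, is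
    squeezed against the upper parabola at [(t0, x0)]. The squares involved add up to at most
    [8 * h ^+ 2]; division by [2 * e] and by [h] leaves [4 * h / e]. *)
Lemma supconv_gradient_close h k l : 0 < h -> `|k| <= h -> `|l| <= h ->
  `|al (t0 + k) (x0 + l) - al t0 x0| <= 4 * h / e /\
  `|be (t0 + k) (x0 + l) - be t0 x0| <= 4 * h / e.
Proof.
move=> h0; rewrite !ler_norml => /andP[k1 k2] /andP[l1 l2].
have base := supconv_semiconvex t0 x0 k l.
have E y : y / (2 * e) = y / 2 * e^-1 by field; rewrite gt_eqF.
have i0 : 0 < e^-1 by rewrite invr_gt0.
have key j : (j = h \/ j = - h) ->
   (al (t0 + k) (x0 + l) - al t0 x0) * j <= 4 * h ^+ 2 * e^-1 /\
   (be (t0 + k) (x0 + l) - be t0 x0) * j <= 4 * h ^+ 2 * e^-1.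
  move=> hj; have jj : j ^+ 2 = h ^+ 2 by case: hj => ->; rewrite ?sqrrN.
  have := supconv_semiconvex (t0 + k) (x0 + l) j 0.
  have := supconv_semiconvex (t0 + k) (x0 + l) 0 j.
  have := upper (k + j) l; have := upper k (l + j).
  rewrite !mulr0 !addr0 !addrA !E expr0n /= !addr0 !add0r jj.
  move: base; rewrite !E.
  set F0 := f t0 x0; set F1 := f _ _; set F2 := f _ _; set F3 := f _ _.
  set a0 := al t0 x0; set b0 := be t0 x0; set a1 := al _ _; set b1 := be _ _.
  move=> base u1 u2 v1 v2.
  have bnd y z : -h <= y <= h -> -h <= z <= h ->
      ((y + j) ^+ 2 + z ^+ 2) + (y ^+ 2 + z ^+ 2) + h ^+ 2 <= 8 * h ^+ 2.
    by move=> /andP[? ?] /andP[? ?]; case: hj => ->; nra.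
  have : (((k + j) ^+ 2 + l ^+ 2) + (k ^+ 2 + l ^+ 2) + h ^+ 2) / 2 * e^-1
      <= 4 * h ^+ 2 * e^-1.
    by rewrite ler_pM2r//; have := bnd k l; rewrite k1 k2 l1 l2 => /(_ isT isT); lra.
  have : (((l + j) ^+ 2 + k ^+ 2) + (l ^+ 2 + k ^+ 2) + h ^+ 2) / 2 * e^-1
      <= 4 * h ^+ 2 * e^-1.
    by rewrite ler_pM2r//; have := bnd l k; rewrite k1 k2 l1 l2 => /(_ isT isT); lra.
  lra.
have [p1 p2] := key h (or_introl erefl); have [m1 m2] := key (-h) (or_intror erefl).
split; apply/andP; split; rewrite -(ler_pM2r h0); lra.
Qed.

(** A touching of [f] from above near [(t0, x0)] with second x-derivative [Q] would carry over to
    [u] at a nearby contact point, with almost the same value and slopes, where [H] is still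
    positive. *)
Lemma supconv_midconvex (H : R * R * R * R -> R) (A : R -> R -> Prop) Q rho :
  continuous H -> quadratic_subsolution H A u -> 0 < rho ->
  (forall k l, `|k| < rho -> `|l| < rho ->
    K (s1 t0 x0 + k) (s2 t0 x0 + l) /\ A (s1 t0 x0 + k) (s2 t0 x0 + l)) ->
  0 < H (u (s1 t0 x0) (s2 t0 x0), al t0 x0, be t0 x0, Q) ->
  exists2 h0 : R, 0 < h0 & forall h, 0 < h -> h <= h0 ->
    f t0 x0 <= (f t0 (x0 + h) + f t0 (x0 - h)) / 2 - Q / 2 * h ^+ 2.
Proof.
move=> cH subu rho0 inner Hpos.
have [d d0 dH] := continuous4_pos (cH _) Hpos.
have i0 : 0 < e^-1 by rewrite invr_gt0.
pose L := `|al t0 x0| + `|be t0 x0|.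
have L0 : 0 <= L by rewrite /L addr_ge0.
pose N := 9 * L + 30 * e^-1 + 1.
have N0 : 0 < N by rewrite /N; lra.
(* Slopes change by at most [4 * h / e], so contact points move by at most [5 * h], which [rho / 10]
   keeps within half of [rho]. The value of [u] changes by at most [h * (L + e^-1)] from [f] and
   [h * (4 * L + 8 * e^-1)] from each squared slope; [N] dominates the total. *)
pose h0 := Num.min 1 (Num.min (rho / 10) (d / (2 * N))).
have h00 : 0 < h0 by rewrite !lt_min ltr01 !divr_gt0// mulr_gt0.
exists h0 => // h hp; rewrite !le_min => /and3P[h1 hr hd].
have {}hd : h * N < d.
  have : h * (2 * N) <= d by rewrite -ler_pdivlMr ?mulr_gt0.
  have := mulr_gt0 hp N0; lra.
have hei : h * (30 * e^-1) < d.
  apply: le_lt_trans hd; rewrite ler_pM2l// /N; lra.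
have hL : h * (9 * L + 30 * e^-1) < d.
  apply: le_lt_trans hd; rewrite ler_pM2l// /N; lra.
have hie : 0 < h * e^-1 by rewrite mulr_gt0.
have gr t x : `|t - t0| <= h -> `|x - x0| <= h ->
    `|al t x - al t0 x0| <= 4 * (h * e^-1) /\ `|be t x - be t0 x0| <= 4 * (h * e^-1).
  move=> tB xB; have := supconv_gradient_close hp tB xB.
  by rewrite ![t0 + _]addrC ![x0 + _]addrC !subrK !mulrA.
(* Lipschitz constant: slopes are at most [L + 4 * (h * e^-1)] on the box, and the quadratic term of
   the lower parabola, over a distance of at most [2 * h], adds [h * e^-1]. *)
apply: (@midconvex_of_no_touching R f t0 x0 h Q (L + 5 * (h * e^-1))) => //.
- by rewrite addr_ge0// mulr_ge0// ltW.
- move=> t x t' x' tB xB tB' xB'.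
  have := supconv_semiconvex t x (t' - t) (x' - x).
  rewrite (addrC t (t' - t)) (addrC x (x' - x)) !subrK.
  have [ga gb] := gr _ _ tB xB.
  have na : `|al t x| <= L + 4 * (h * e^-1).
    have := ler_normD (al t x - al t0 x0) (al t0 x0); rewrite subrK /L.
    have := normr_ge0 (be t0 x0); lra.
  have nb : `|be t x| <= L + 4 * (h * e^-1).
    have := ler_normD (be t x - be t0 x0) (be t0 x0); rewrite subrK /L.
    have := normr_ge0 (al t0 x0); lra.
  have E y : y / (2 * e) = y / 2 * e^-1 by field; rewrite gt_eqF.
  have sq y : `|y| <= 2 * h -> y ^+ 2 / 2 * e^-1 <= h * e^-1 * `|y|.
    move=> yh; rewrite -[y ^+ 2]real_normK ?num_real//.
    have := normr_ge0 y; set z := `|y| in yh * => z0.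
    rewrite [h * _ * _]mulrAC ler_pM2r//; nra.
  have sqt : (t' - t) ^+ 2 / 2 * e^-1 <= h * e^-1 * `|t - t'|.
    rewrite (distrC t); apply: sq; have := ler_normB (t' - t0) (t - t0).
    rewrite (_ : t' - t0 - _ = t' - t); [lra|ring].
  have sqx : (x' - x) ^+ 2 / 2 * e^-1 <= h * e^-1 * `|x - x'|.
    rewrite (distrC x); apply: sq; have := ler_normB (x' - x0) (x - x0).
    rewrite (_ : x' - x0 - _ = x' - x); [lra|ring].
  have at_ : - (al t x * (t' - t)) <= (L + 4 * (h * e^-1)) * `|t - t'|.
    rewrite (le_trans (ler_norm _))// normrN normrM (distrC t) ler_wpM2r//.
  have bx_ : - (be t x * (x' - x)) <= (L + 4 * (h * e^-1)) * `|x - x'|.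
    rewrite (le_trans (ler_norm _))// normrN normrM (distrC x) ler_wpM2r//.
  rewrite E; lra.
move=> t x a b p r tB xB r0 touch.
have [ga gb] := gr _ _ (ltW tB) (ltW xB).
have ala : al t x = a.
  apply/eqP; rewrite -subr_eq0; apply/eqP.
  apply: (@linear_le_quadratic_eq0 _ (b + (2 * e)^-1) r r0) => k kr.
  have := supconv_semiconvex t x k 0; have := touch k 0 kr.
  rewrite normr0 => /(_ r0); rewrite !mulr0 !addr0 expr0n /= mulr0 !addr0.
  lra.
have beb : be t x = p.
  apply/eqP; rewrite -subr_eq0; apply/eqP.
  apply: (@linear_le_quadratic_eq0 _ (Q / 2 + (2 * e)^-1) r r0) => k kr.
  have := supconv_semiconvex t x 0 k; have := touch 0 k.
  rewrite normr0 => /(_ r0 kr); rewrite !mulr0 !addr0 expr0n /= mulr0 !addr0 !add0r.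
  lra.
have s1E : s1 t x = t + e * al t x by rewrite /al; field; rewrite gt_eqF.
have s2E : s2 t x = x + e * be t x by rewrite /be; field; rewrite gt_eqF.
have s1E0 : s1 t0 x0 = t0 + e * al t0 x0 by rewrite /al; field; rewrite gt_eqF.
have s2E0 : s2 t0 x0 = x0 + e * be t0 x0 by rewrite /be; field; rewrite gt_eqF.
have eK y : `|y| <= 4 * (h * e^-1) -> `|e * y| <= 4 * h.
  move=> yh; rewrite normrM gtr0_norm// mulrC -ler_pdivlMr//.
  by rewrite -mulrA.
have near1 : `|s1 t x - s1 t0 x0| <= 5 * h.
  rewrite s1E s1E0 (_ : _ - _ = (t - t0) + e * (al t x - al t0 x0)); last by ring.
  by apply: le_trans (ler_normD _ _) _; have := eK _ ga; lra.
have near2 : `|s2 t x - s2 t0 x0| <= 5 * h.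
  rewrite s2E s2E0 (_ : _ - _ = (x - x0) + e * (be t x - be t0 x0)); last by ring.
  by apply: le_trans (ler_normD _ _) _; have := eK _ gb; lra.
have inK k l : `|k| < rho - 5 * h -> `|l| < rho - 5 * h ->
    K (s1 t x + k) (s2 t x + l) /\ A (s1 t x + k) (s2 t x + l).
  move=> kr lr.
  have := inner (s1 t x - s1 t0 x0 + k) (s2 t x - s2 t0 x0 + l).
  rewrite (_ : s1 t0 x0 + _ = s1 t x + k); last by ring.
  rewrite (_ : s2 t0 x0 + _ = s2 t x + l); last by ring.
  apply.
    by apply: le_lt_trans (ler_normD _ _) _; lra.
  by apply: le_lt_trans (ler_normD _ _) _; lra.
have rh : 0 < rho - 5 * h by lra.
(* Displacing [(t, x)] and its contact point by the same vector leaves the penalty unchanged, so the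
   quadratic touching [f] also touches [u], with the same coefficients. *)
have /= : H (u (s1 t x) (s2 t x), a, p, Q) <= 0.
  apply: (subu _ _ _ _ b _ _ (Num.min r (rho - 5 * h))).
  - by have := inK 0 0; rewrite !addr0 !normr0 => /(_ rh rh)[].
  - by rewrite lt_min r0.
  - move=> k l; rewrite !lt_min => /andP[kr krho] /andP[lr lrho].
    have := maxs (t + k) (x + l) (inK k l krho lrho).1.
    rewrite (_ : t + k - _ = t - s1 t x); last by ring.
    rewrite (_ : x + l - _ = x - s2 t x); last by ring.
    have := touch k l kr lr; rewrite /f; lra.
apply/negP; rewrite -ltNge; apply: dH; rewrite ?subrr ?normr0//; last 2 first.
- by rewrite -ala; lra.
- by rewrite -beb; lra.
(* At contact points [u = f + e / 2 * (al ^+ 2 + be ^+ 2)]; the differences of squares are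
   factored. *)
have -> : u (s1 t x) (s2 t x) - u (s1 t0 x0) (s2 t0 x0) = f t x - f t0 x0 +
    e / 2 * ((al t x - al t0 x0) * (al t x + al t0 x0) +
             (be t x - be t0 x0) * (be t x + be t0 x0)).
  by rewrite /f /al /be; field; rewrite gt_eqF.
have nf : `|f t x - f t0 x0| <= h * (L + e^-1).
  have := upper (t - t0) (x - x0); have := supconv_semiconvex t0 x0 (t - t0) (x - x0).
  rewrite ![t0 + _]addrC ![x0 + _]addrC !subrK.
  have b1 : `|al t0 x0 * (t - t0)| <= `|al t0 x0| * h by rewrite normrM ler_wpM2l// ltW.
  have b2 : `|be t0 x0 * (x - x0)| <= `|be t0 x0| * h by rewrite normrM ler_wpM2l// ltW.
  have b3 : ((t - t0) ^+ 2 + (x - x0) ^+ 2) / (2 * e) <= h * e^-1.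
    have -> : ((t - t0) ^+ 2 + (x - x0) ^+ 2) / (2 * e) =
      ((t - t0) ^+ 2 + (x - x0) ^+ 2) / 2 * e^-1 by field; rewrite gt_eqF.
    rewrite ler_pM2r// -[(t - t0) ^+ 2]real_normK ?num_real//.
    rewrite -[(x - x0) ^+ 2]real_normK ?num_real//.
    have := normr_ge0 (t - t0); have := normr_ge0 (x - x0); nra.
  move: b1 b2; rewrite !ler_norml /L => /andP[? ?] /andP[? ?]; lra.
have ng y z : `|y| <= 4 * (h * e^-1) -> `|z| <= 2 * L + 4 * (h * e^-1) ->
    `|e / 2 * (y * z)| <= h * (4 * L + 8 * e^-1).
  move=> yh zh; rewrite mulrA normrM mulrAC normrM [`|2^-1|]ger0_norm ?invr_ge0//.
  have := eK _ yh; set Y := `|e * y| => Yh; set Z := `|z| in zh *.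
  have Y0 : 0 <= Y := normr_ge0 _; have Z0 : 0 <= Z := normr_ge0 _.
  have : Y / 2 * Z <= 2 * h * (2 * L + 4 * (h * e^-1)) by apply: ler_pM => //; lra.
  have : h * (h * e^-1) <= h * e^-1 by rewrite ler_piMl// ltW.
  lra.
rewrite mulrDr; apply: le_lt_trans (ler_normD _ _) _.
have g1 : `|al t x + al t0 x0| <= 2 * L + 4 * (h * e^-1).
  have := ler_normD (al t x - al t0 x0) (al t0 x0 *+ 2).
  rewrite (_ : _ - _ + _ = al t x + al t0 x0); last by ring.
  rewrite normrMn /L; have := normr_ge0 (be t0 x0); lra.
have g2 : `|be t x + be t0 x0| <= 2 * L + 4 * (h * e^-1).
  have := ler_normD (be t x - be t0 x0) (be t0 x0 *+ 2).
  rewrite (_ : _ - _ + _ = be t x + be t0 x0); last by ring.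
  rewrite normrMn /L; have := normr_ge0 (al t0 x0); lra.
have := ler_normD (e / 2 * ((al t x - al t0 x0) * (al t x + al t0 x0)))
  (e / 2 * ((be t x - be t0 x0) * (be t x + be t0 x0))).
have := ng _ _ ga g1; have := ng _ _ gb g2; lra.
Qed.

End SupConvolution.

(** * Doubling of variables *)

Section Doubling.
Context {R : realType}.
Implicit Types (t x a b p q r h k l c d e Q : R) (u v : R -> R -> R).

(** Let [Q] be the supremum of the set where [h1] is positive. Openness gives [h1 Q <= 0], hence
    [0 < h2 (- Q)], and this persists slightly above [- Q], while [h1] is positive arbitrarily close
    to [Q]. The first two alternatives cover the cases where that set may be unbounded or empty. *)
Lemma split_threshold (h1 h2 : R -> R) c :
  {homo h1 : q q' /~ q <= q'} ->
  (forall q, 0 < h1 q -> exists2 d : R, 0 < d & forall q', `|q' - q| < d -> 0 < h1 q') ->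
  (forall q, 0 < h2 q -> exists2 d : R, 0 < d & forall q', `|q' - q| < d -> 0 < h2 q') ->
  (forall q, 0 < h1 q + h2 (- q)) ->
  [\/ 0 < h1 c, 0 < h2 c | exists Q1 Q2 : R, [/\ 0 < Q1 + Q2, 0 < h1 Q1 & 0 < h2 Q2]].
Proof.
move=> dec1 open1 open2 sum0.
have [|h1c] := ltP 0 (h1 c); first by constructor 1.
have [|h2c] := ltP 0 (h2 c); first by constructor 2.
constructor 3; pose S := [set q | 0 < h1 q]; pose Q := sup S.
have supS : has_sup S.
  split; first by exists (- c); have := sum0 (- c); rewrite /S /= opprK; lra.
  exists c => q /= q0; rewrite leNgt; apply/negP => cq.
  by have := dec1 _ _ (ltW cq); move: q0; rewrite /S /=; lra.
have h1Q : h1 Q <= 0.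
  rewrite leNgt; apply/negP => /open1[d d0 dQ].
  have : Q + d / 2 <= Q.
    apply: ub_le_sup; first by case: supS.
    by apply: dQ; rewrite addrAC subrr add0r gtr0_norm; lra.
  lra.
have : 0 < h2 (- Q) by have := sum0 Q; lra.
move=> /open2[d d0 dQ].
have d4 : 0 < d / 4 by lra.
have [q q0 Qq] := sup_adherent d4 supS.
exists q, (- Q + d / 2); split => //; first by rewrite -/Q in Qq; lra.
by apply: dQ; rewrite addrAC subrr add0r gtr0_norm; lra.
Qed.

(* The two sup-convolutions have a global maximum of their sum at the midpoint of
   the doubling maximum; there each one is pinched between two parabolas, so both are
   convex enough in x to exclude a maximum. *)
Lemma no_interior_doubling_max (H1 H2 : R * R * R * R -> R)
    (K A : R -> R -> Prop) u v e rho a1 b1 a2 b2 :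
  continuous H1 -> continuous H2 -> cond_A0 H1 ->
  quadratic_subsolution H1 A u -> quadratic_subsolution H2 A v -> 0 < e -> 0 < rho ->
  (forall t x, exists s, K s.1 s.2 /\ forall a b, K a b ->
    u a b - ((t - a) ^+ 2 + (x - b) ^+ 2) / (2 * e) <=
    u s.1 s.2 - ((t - s.1) ^+ 2 + (x - s.2) ^+ 2) / (2 * e)) ->
  (forall t x, exists s, K s.1 s.2 /\ forall a b, K a b ->
    v a b - ((t - a) ^+ 2 + (x - b) ^+ 2) / (2 * e) <=
    v s.1 s.2 - ((t - s.1) ^+ 2 + (x - s.2) ^+ 2) / (2 * e)) ->
  (forall k l, `|k| < rho -> `|l| < rho -> K (a1 + k) (b1 + l) /\ A (a1 + k) (b1 + l)) ->
  (forall k l, `|k| < rho -> `|l| < rho -> K (a2 + k) (b2 + l) /\ A (a2 + k) (b2 + l)) ->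
  (forall a b a' b', K a b -> K a' b' ->
    u a b + v a' b' - ((a - a') ^+ 2 + (b - b') ^+ 2) / (4 * e) <=
    u a1 b1 + v a2 b2 - ((a1 - a2) ^+ 2 + (b1 - b2) ^+ 2) / (4 * e)) ->
  (forall q, 0 < H1 (u a1 b1, (a1 - a2) / (2 * e), (b1 - b2) / (2 * e), q) +
     H2 (v a2 b2, - ((a1 - a2) / (2 * e)), - ((b1 - b2) / (2 * e)), - q)) -> False.
Proof.
move=> cH1 cH2 dec1 subu subv e0 rho0 maxu maxv in1 in2 dmax Hpos.
pose t0 := (a1 + a2) / 2; pose x0 := (b1 + b2) / 2.
pose M := u a1 b1 + v a2 b2 - ((a1 - a2) ^+ 2 + (b1 - b2) ^+ 2) / (4 * e).
have K1 : K a1 b1 by have := in1 0 0; rewrite !addr0 normr0 => /(_ rho0 rho0)[].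
have K2 : K a2 b2 by have := in2 0 0; rewrite !addr0 normr0 => /(_ rho0 rho0)[].
(* The parallelogram identity: the two penalties with [2 * e] exceed the single one with [4 * e] by
   a square that vanishes when [(t, x)] is the midpoint. *)
have sumM t x a b a' b' : K a b -> K a' b' ->
    u a b - ((t - a) ^+ 2 + (x - b) ^+ 2) / (2 * e) +
    (v a' b' - ((t - a') ^+ 2 + (x - b') ^+ 2) / (2 * e)) <= M.
  move=> Kab Kab'; apply: le_trans (dmax _ _ _ _ Kab Kab'); rewrite -subr_ge0.
  rewrite [leRHS](_ : _ = ((2 * t - a - a') ^+ 2 + (2 * x - b - b') ^+ 2) / (4 * e)).
    by rewrite divr_ge0 ?addr_ge0 ?sqr_ge0// mulr_ge0// ltW.
  by field; rewrite gt_eqF.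
have at0 : u a1 b1 - ((t0 - a1) ^+ 2 + (x0 - b1) ^+ 2) / (2 * e) +
    (v a2 b2 - ((t0 - a2) ^+ 2 + (x0 - b2) ^+ 2) / (2 * e)) = M.
  by rewrite /M /t0 /x0; field; rewrite gt_eqF.
(* Maximizers need not be unique; the choice at the midpoint is forced to be the doubling maximum,
   because the slopes there must match. *)
have ex_u (w : R * R) : exists s : R * R, [/\ K s.1 s.2, (forall a b, K a b ->
    u a b - ((w.1 - a) ^+ 2 + (w.2 - b) ^+ 2) / (2 * e) <=
    u s.1 s.2 - ((w.1 - s.1) ^+ 2 + (w.2 - s.2) ^+ 2) / (2 * e)) &
    w = (t0, x0) -> s = (a1, b1)].
  have [->|ne] := pselect (w = (t0, x0)); last first.
    by have [s [? ?]] := maxu w.1 w.2; exists s; split.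
  exists (a1, b1); split => //= a b Kab.
  have := sumM t0 x0 a b a2 b2 Kab K2; lra.
have ex_v (w : R * R) : exists s : R * R, [/\ K s.1 s.2, (forall a b, K a b ->
    v a b - ((w.1 - a) ^+ 2 + (w.2 - b) ^+ 2) / (2 * e) <=
    v s.1 s.2 - ((w.1 - s.1) ^+ 2 + (w.2 - s.2) ^+ 2) / (2 * e)) &
    w = (t0, x0) -> s = (a2, b2)].
  have [->|ne] := pselect (w = (t0, x0)); last first.
    by have [s [? ?]] := maxv w.1 w.2; exists s; split.
  exists (a2, b2); split => //= a b Kab.
  have := sumM t0 x0 a1 b1 a b K1 Kab; lra.
have [su /all_and3[Ku mu u0]] := choice ex_u.
have [sv /all_and3[Kv mv v0]] := choice ex_v.
have {}u0 := u0 (t0, x0) erefl; have {}v0 := v0 (t0, x0) erefl.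
pose su1 t x := (su (t, x)).1; pose su2 t x := (su (t, x)).2.
pose sv1 t x := (sv (t, x)).1; pose sv2 t x := (sv (t, x)).2.
have E1 : su1 t0 x0 = a1 by rewrite /su1 u0.
have E2 : su2 t0 x0 = b1 by rewrite /su2 u0.
have E3 : sv1 t0 x0 = a2 by rewrite /sv1 v0.
have E4 : sv2 t0 x0 = b2 by rewrite /sv2 v0.
pose f t x := u (su1 t x) (su2 t x) -
  ((t - su1 t x) ^+ 2 + (x - su2 t x) ^+ 2) / (2 * e).
pose g t x := v (sv1 t x) (sv2 t x) -
  ((t - sv1 t x) ^+ 2 + (x - sv2 t x) ^+ 2) / (2 * e).
have fgM t x : f t x + g t x <= M by exact: sumM (Ku _) (Kv _).
have fgM0 : f t0 x0 + g t0 x0 = M by rewrite /f /g E1 E2 E3 E4.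
have al1 : (su1 t0 x0 - t0) / e = (a1 - a2) / (2 * e).
  by rewrite E1 /t0; field; rewrite gt_eqF.
have be1 : (su2 t0 x0 - x0) / e = (b1 - b2) / (2 * e).
  by rewrite E2 /x0; field; rewrite gt_eqF.
have al2 : (sv1 t0 x0 - t0) / e = - ((a1 - a2) / (2 * e)).
  by rewrite E3 /t0; field; rewrite gt_eqF.
have be2 : (sv2 t0 x0 - x0) / e = - ((b1 - b2) / (2 * e)).
  by rewrite E4 /x0; field; rewrite gt_eqF.
have scf := @supconv_semiconvex R K u e su1 su2 e0 (fun t x => Ku (t, x))
  (fun t x => mu (t, x)).
have scg := @supconv_semiconvex R K v e sv1 sv2 e0 (fun t x => Kv (t, x))
  (fun t x => mv (t, x)).
have upf k l : f (t0 + k) (x0 + l) <= f t0 x0 + (su1 t0 x0 - t0) / e * k +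
    (su2 t0 x0 - x0) / e * l + (k ^+ 2 + l ^+ 2) / (2 * e).
  have := scg t0 x0 k l; have := fgM (t0 + k) (x0 + l).
  rewrite al1 be1 al2 be2 -/(g t0 x0) -/(g (t0 + k) (x0 + l)); lra.
have upg k l : g (t0 + k) (x0 + l) <= g t0 x0 + (sv1 t0 x0 - t0) / e * k +
    (sv2 t0 x0 - x0) / e * l + (k ^+ 2 + l ^+ 2) / (2 * e).
  have := scf t0 x0 k l; have := fgM (t0 + k) (x0 + l).
  rewrite al1 be1 al2 be2 -/(f t0 x0) -/(f (t0 + k) (x0 + l)); lra.
pose conv (F : R -> R -> R) Q := exists2 h0, 0 < h0 & forall h, 0 < h -> h <= h0 ->
    F t0 x0 <= (F t0 (x0 + h) + F t0 (x0 - h)) / 2 - Q / 2 * h ^+ 2.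
have convf Q : 0 < H1 (u a1 b1, (a1 - a2) / (2 * e), (b1 - b2) / (2 * e), Q) -> conv f Q.
  move=> Q0; apply: (@supconv_midconvex R K u e su1 su2 e0 (fun t x => Ku (t, x))
  (fun t x => mu (t, x)) t0 x0 upf H1 A Q rho) => //.
    by rewrite E1 E2.
  by rewrite al1 be1 E1 E2.
have convg Q : 0 < H2 (v a2 b2, - ((a1 - a2) / (2 * e)), - ((b1 - b2) / (2 * e)), Q) ->
    conv g Q.
  move=> Q0; apply: (@supconv_midconvex R K v e sv1 sv2 e0 (fun t x => Kv (t, x))
  (fun t x => mv (t, x)) t0 x0 upg H2 A Q rho) => //.
    by rewrite E3 E4.
  by rewrite al2 be2 E3 E4.
have E y : y / (2 * e) = y / 2 * e^-1 by field; rewrite gt_eqF.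
have convf0 : conv f (- e^-1).
  exists 1 => // h _ _; have := scf t0 x0 0 h; have := scf t0 x0 0 (- h).
  rewrite !addr0 !mulr0 !addr0 sqrrN !expr0n /= !add0r.
  by rewrite -/(f t0 x0) -/(f t0 (x0 + h)) -/(f t0 (x0 - h)) !E; lra.
have convg0 : conv g (- e^-1).
  exists 1 => // h _ _; have := scg t0 x0 0 h; have := scg t0 x0 0 (- h).
  rewrite !addr0 !mulr0 !addr0 sqrrN !expr0n /= !add0r.
  by rewrite -/(g t0 x0) -/(g t0 (x0 + h)) -/(g t0 (x0 - h)) !E; lra.
have contra Q1 Q2 : 0 < Q1 + Q2 -> conv f Q1 -> conv g Q2 -> False.
  move=> Q0 [d1 d10 cf] [d2 d20 cg].
  pose h := Num.min d1 d2; have hp : 0 < h by rewrite lt_min d10.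
  have := cf h hp; have := cg h hp; rewrite /h !ge_min !lexx orbT /= -/h.
  move=> /(_ isT) ? /(_ isT) ?; have := fgM t0 (x0 + h); have := fgM t0 (x0 - h).
  have : 0 < (Q1 + Q2) * h ^+ 2 by rewrite mulr_gt0// exprn_gt0.
  lra.
(* Semiconvexity alone gives each convolution the convexity constant [- e^-1]; a threshold
   [e^-1 + 1] for the other one therefore already contradicts the maximum. *)
case: (@split_threshold
  (fun q => H1 (u a1 b1, (a1 - a2) / (2 * e), (b1 - b2) / (2 * e), q))
  (fun q => H2 (v a2 b2, - ((a1 - a2) / (2 * e)), - ((b1 - b2) / (2 * e)), q))
  (e^-1 + 1)) => //.
- by move=> q q' qq; exact: dec1.
- move=> q /(continuous4_pos (cH1 _))[d d0 dq]; exists d => // q' qq.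
  by apply: dq => //; rewrite subrr normr0.
- move=> q /(continuous4_pos (cH2 _))[d d0 dq]; exists d => // q' qq.
  by apply: dq => //; rewrite subrr normr0.
- by move=> /convf cf; apply: (contra _ _ _ cf convg0); lra.
- by move=> /convg cg; apply: (contra _ _ _ convf0 cg); lra.
- by move=> [Q1 [Q2 [Q0 /convf cf /convg cg]]]; exact: contra Q0 cf cg.
Qed.

End Doubling.

(** * The comparison principle *)

Section UscWithin.
Context {R : realType}.

Definition usc_within (X : topologicalType) (K : set X) (F : X -> R) :=
  forall x M, K x -> F x < M -> \forall y \near x, K y -> F y < M.

Lemma usc_withinD (X : topologicalType) (K : set X) (F1 F2 : X -> R) :
  usc_within K F1 -> usc_within K F2 -> usc_within K (fun x => F1 x + F2 x).
Proof.
move=> usc1 usc2 x M Kx FM; pose e := (M - (F1 x + F2 x)) / 2.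
have /(usc1 _ _ Kx) n1 : F1 x < F1 x + e by rewrite ltrDl /e; lra.
have /(usc2 _ _ Kx) n2 : F2 x < F2 x + e by rewrite ltrDl /e; lra.
apply: filterS2 n1 n2 => y h1 h2 Ky; have := h1 Ky; have := h2 Ky.
rewrite /e; lra.
Qed.

Lemma usc_within_continuous (X : topologicalType) (K : set X) (F : X -> R) :
  (forall x, K x -> {for x, continuous F}) -> usc_within K F.
Proof.
move=> cF x M Kx FM.
have : \forall y \near x, F y < M by exact: cvgr_lt (cF x Kx) _ FM.
by apply: filterS => y yM _.
Qed.

Lemma usc_within_fst (X Y : topologicalType) (K : set X) (L : set Y) (F : X -> R) :
  usc_within K F -> usc_within (K `*` L) (fun w => F w.1).
Proof.
move=> uscF w M [Kw _] /(uscF _ _ Kw) near1.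
have : \forall y \near w, K y.1 -> F y.1 < M by exact: (cvg_fst near1).
by apply: filterS => y yM [/yM].
Qed.

Lemma usc_within_snd (X Y : topologicalType) (K : set X) (L : set Y) (F : Y -> R) :
  usc_within L F -> usc_within (K `*` L) (fun w => F w.2).
Proof.
move=> uscF w M [_ Lw] /(uscF _ _ Lw) near1.
have : \forall y \near w, L y.2 -> F y.2 < M by exact: (cvg_snd near1).
by apply: filterS => y yM [_ /yM].
Qed.

Lemma usc_within_subset (X : topologicalType) (K L : set X) (F : X -> R) :
  L `<=` K -> usc_within K F -> usc_within L F.
Proof.
move=> LK uscF x M Lx /(uscF _ _ (LK _ Lx)); apply: filterS => y yM Ly.
exact/yM/LK.
Qed.

(** Keeps the doubling maximum off the boundary [B]. Both orders are stated, since either of the two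
    nearby points may be the one in [B]. *)
Lemma usc_within_near_diagonal (K B : set (R * R)) (F1 F2 : R * R -> R) M :
  compact B -> B `<=` K -> usc_within K F1 -> usc_within K F2 ->
  (forall w, B w -> F1 w + F2 w < M) ->
  exists2 d : R, 0 < d & forall y z, B y -> K z -> `|y.1 - z.1| < d ->
    `|y.2 - z.2| < d -> F1 y + F2 z < M /\ F1 z + F2 y < M.
Proof.
move=> /compact_near_coveringP/near_covering_withinP cB BK usc1 usc2 FM.
pose P (d : R) (y : R * R) := forall z, K z -> `|y.1 - z.1| < d ->
    `|y.2 - z.2| < d -> F1 y + F2 z < M /\ F1 z + F2 y < M.
have : \forall d \near (0:R)^'+, B `<=` P d.
  apply: cB => w Bw; have Kw := BK _ Bw.
  pose e := (M - (F1 w + F2 w)) / 2.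
  have e0 : 0 < e by have := FM w Bw; rewrite /e; lra.
  have /(usc1 _ _ Kw)/near_box[r1 r10 n1] : F1 w < F1 w + e by rewrite ltrDl.
  have /(usc2 _ _ Kw)/near_box[r2 r20 n2] : F2 w < F2 w + e by rewrite ltrDl.
  pose r := Num.min r1 r2; have r0 : 0 < r by rewrite lt_min r10.
  have r2p : 0 < r / 2 by rewrite divr_gt0.
  near=> y d => /= By z Kz dz1 dz2.
  have yw : `|y.1 - w.1| < r / 2 /\ `|y.2 - w.2| < r / 2.
    near: y; apply/near_box; exists (r / 2) => //.
  have dr : d < r / 2 by near: d; exact: nbhs_right_lt.
  have [yw1 yw2] := yw.
  have zw1 : `|z.1 - w.1| < r.
    by have := ler_distD y.1 z.1 w.1; rewrite (distrC z.1 y.1); lra.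
  have zw2 : `|z.2 - w.2| < r.
    by have := ler_distD y.2 z.2 w.2; rewrite [`|z.2 - y.2|]distrC; lra.
  have [rr1 rr2] : r <= r1 /\ r <= r2 by rewrite !ge_min !lexx orbT.
  have f1y : F1 y < F1 w + e by apply: n1; [lra|lra|exact: BK].
  have f1z : F1 z < F1 w + e by apply: n1; [lra|lra|].
  have f2y : F2 y < F2 w + e by apply: n2; [lra|lra|exact: BK].
  have f2z : F2 z < F2 w + e by apply: n2; [lra|lra|].
  by move: f1y f1z f2y f2z; rewrite /e; split; lra.
move=> near_d; have [d [d0 Pd]] : exists d : R, 0 < d /\ B `<=` P d.
  near (0:R)^'+ => d; exists d; split => //; by near: d.
by exists d => // y z By; exact: Pd.
Unshelve. all: by end_near. Qed.

End UscWithin.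

Section ContinuityTools.
Context {R : realType}.

Lemma continuous_sqr (X : topologicalType) (f : X -> R) x :
  {for x, continuous f} -> {for x, continuous (fun y => f y ^+ 2)}.
Proof. by move=> cf; exact: (continuousM cf cf). Qed.

Lemma continuous_quadruple (X : topologicalType) (f1 f2 f3 f4 : X -> R) x :
  {for x, continuous f1} -> {for x, continuous f2} ->
  {for x, continuous f3} -> {for x, continuous f4} ->
  {for x, continuous (fun y => (f1 y, f2 y, f3 y, f4 y))}.
Proof.
have cp (Y Z : topologicalType) (f : X -> Y) (g : X -> Z) :
    {for x, continuous f} -> {for x, continuous g} ->
    {for x, continuous (fun y => (f y, g y))}.
  by move=> cf cg; exact: cvg_pair cf cg.
by move=> c1 c2 c3 c4; exact: (cp _ _ _ _ (cp _ _ _ _ (cp _ _ _ _ c1 c2) c3) c4).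
Qed.

Lemma continuous_coordinates4 (w : R * R * R * R) :
  [/\ {for w, continuous (fun w : R * R * R * R => w.1.1.1)},
      {for w, continuous (fun w : R * R * R * R => w.1.1.2)},
      {for w, continuous (fun w : R * R * R * R => w.1.2)} &
      {for w, continuous (fun w : R * R * R * R => w.2)}].
Proof.
have f1 (X Y : topologicalType) : continuous (@fst X Y) by move=> ?; exact: cvg_fst.
have f2 (X Y : topologicalType) : continuous (@snd X Y) by move=> ?; exact: cvg_snd.
have f11 (X Y Z : topologicalType) : continuous (fun w : X * Y * Z => w.1.1).
  by move=> z; exact: (cvg_comp _ _ (f1 _ _ z) (f1 _ _ z.1)).
split; last exact: f2.
- exact: (cvg_comp _ _ (f11 _ _ _ w) (f1 _ _ w.1.1)).
- exact: (cvg_comp _ _ (f11 _ _ _ w) (f2 _ _ w.1.1)).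
- exact: (cvg_comp _ _ (f1 _ _ w) (f2 _ _ w.1)).
Qed.

End ContinuityTools.

Section Comparison.
Context {R : realType}.
Implicit Types (T : \bar R) (m t x : R) (u v : R -> R -> R).

(** Explicit form of [Omega_bar T m] for [0 < m]. *)
Definition slab T m : set (R * R) := [set w | 0 <= w.1 /\ (w.1%:E < T)%E /\ 0 <= w.2 <= m].

(** The equation of which [- v] is a subsolution when [v] is a supersolution for [G]; only
    sup-convolutions then have to be treated. *)
Definition mirror (G : R * R * R * R -> R) : R * R * R * R -> R :=
  fun w => - G (- w.1.1.1, - w.1.1.2, - w.1.2, - w.2).

Lemma mirror_continuous G : continuous G -> continuous (mirror G).
Proof.
move=> cG w; apply: (@continuousN _ _ _
  (fun w : R * R * R * R => G (- w.1.1.1, - w.1.1.2, - w.1.2, - w.2))).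
apply: (@continuous_comp _ _ _
  (fun w : R * R * R * R => (- w.1.1.1, - w.1.1.2, - w.1.2, - w.2)) G); last exact: cG.
have [h1 h2 h3 h4] := continuous_coordinates4 w.
by apply: continuous_quadruple; exact: continuousN.
Qed.

End Comparison.

Lemma exists_real_between (R : realType) (t : R) (T : \bar R) : (t%:E < T)%E ->
  exists T' : R, t < T' /\ (T'%:E < T)%E.
Proof.
case: T => [r| |] //.
  by rewrite lte_fin => tr; exists ((t + r) / 2); rewrite lte_fin; lra.
by move=> _; exists (t + 1); rewrite ltry; split => //; lra.
Qed.

Section ComparisonPrinciple.
Context {R : realType}.
Implicit Types (T : \bar R) (m t x : R) (u v : R * R -> R) (G : R * R * R * R -> R).

Definition quadratic_sub G T m u :=
  quadratic_subsolution G (fun t x => Omega T m (t, x)) (fun t x => u (t, x)).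

(* Subtracting [a / (tau - t)], which blows up at [tau > T'], makes the inequality
   strict in both the value and the time derivative. *)
Lemma quadratic_sub_penalized G T m u (T' tau a c : R) :
  cond_A1 G -> quadratic_sub G T m u -> (T'%:E < T)%E -> 0 < a -> T' < tau ->
  c <= a / tau -> c <= a / tau ^+ 2 ->
  quadratic_subsolution (fun w => G (w.1.1.1 + c, w.1.1.2 + c, w.1.2, w.2))
    (fun t x => [/\ 0 < t, t < T', 0 < x & x < m])
    (fun t x => u (t, x) - a / (tau - t)).
Proof.
move=> A1 subu T'T a0 Ttau c1 c2 t x [t0 tT x0 xm] al b p q r r0 touch /=.
have tau0 : 0 < tau by lra.
pose s := tau - t; have s0 : 0 < s by rewrite /s; lra.
have stau : s <= tau by rewrite /s; lra.
pose r' := Num.min r (s / 2).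
have r'0 : 0 < r' by rewrite lt_min r0 divr_gt0.
have inO : Omega T m (t, x).
  by split => //=; rewrite x0 xm (lt_trans _ T'T)// lte_fin.
have : G (u (t, x), al + a / s ^+ 2, p, q) <= 0.
  apply: (subu t x inO _ (b + 2 * a / s ^+ 3) _ _ r' r'0) => k l.
  rewrite !lt_min => /andP[kr ks] /andP[lr _].
  have := touch k l kr lr; rewrite opprD addrA -/s.
  have sk : 0 < s - k by have := ler_norm k; lra.
  (* Twice the Taylor coefficient in the quadratic term leaves room for the remainder: the
     difference has the sign of [s - 2 * k], whence the radius [s / 2]. *)
  suff : a / (s - k) <= a / s + a / s ^+ 2 * k + 2 * a / s ^+ 3 * k ^+ 2 by lra.
  rewrite -subr_ge0.
  have -> : a / s + a / s ^+ 2 * k + 2 * a / s ^+ 3 * k ^+ 2 - a / (s - k) =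
      a * k ^+ 2 * (s - 2 * k) / (s ^+ 3 * (s - k)).
    by field; rewrite !gt_eqF.
  apply: divr_ge0; last by apply: mulr_ge0; [rewrite exprn_ge0// ltW|exact: ltW].
  apply: mulr_ge0; last by have := ler_norm k; lra.
  by apply: mulr_ge0; [exact: ltW|exact: sqr_ge0].
apply: le_trans.
have [+ _] := A1 p q (u (t, x) - a / s + c) (u (t, x)) (al + c) (al + a / s ^+ 2).
apply.
  have : a / tau <= a / s by rewrite ler_pM2l// lef_pV2.
  lra.
have : a / tau ^+ 2 <= a / s ^+ 2.
  by rewrite ler_pM2l// lef_pV2 ?posrE ?exprn_gt0// lerXn2r ?nnegrE// ltW.
lra.
Qed.

Lemma comparison G T m u v :
  0 < m -> continuous G -> cond_A0 G -> cond_A1 G ->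
  usc_within (slab T m) u -> usc_within (slab T m) (fun w => - v w) ->
  quadratic_sub G T m u -> quadratic_sub (mirror G) T m (fun w => - v w) ->
  (forall w, slab T m w -> w.1 = 0 \/ w.2 = 0 \/ w.2 = m -> u w <= v w) ->
  forall w, slab T m w -> u w <= v w.
Proof.
move=> m0 cG A0 A1 uscu uscv subu subv bnd [t1 x1] D1; rewrite leNgt; apply/negP => vu.
have [/= t10 [t1T x1m]] := D1.
have [T' [t1T' T'T]] := exists_real_between t1T.
have T'0 : 0 < T' by lra.
pose K := [set w : R * R | 0 <= w.1 <= T' /\ 0 <= w.2 <= m].
have KD : K `<=` slab T m.
  move=> w [/andP[w0 w1] w2]; do 2?split => //.
  by rewrite (le_lt_trans _ T'T)// lee_fin.
have cK : compact K := @compact_box R 0 T' 0 m.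
have K1 : K (t1, x1) by split => //=; lra.
have K0 : K !=set0 by exists (t1, x1).
have [cu Kcu maxu] := compact_usc_max cK K0 (usc_within_subset KD uscu).
have [cv Kcv maxv] := compact_usc_max cK K0 (usc_within_subset KD uscv).
pose C := `|u cu| + `|v cv| + 1.
have C0 : 0 < C by have := normr_ge0 (u cu); have := normr_ge0 (v cv); rewrite /C; lra.
have uC y z : K y -> K z -> u y - v z < C.
  move=> /maxu uy /maxv vz; have := ler_norm (u cu).
  by have := ler_norm (- v cv); rewrite normrN /C; lra.
pose eta := u (t1, x1) - v (t1, x1); have eta0 : 0 < eta by rewrite subr_gt0.
(* The penalty takes less than half of [eta] at [t1], so the penalized difference stays positive
   there; [tau] is such that the penalty equals [C], a strict bound for [u - v], at time [T']. *)
pose a := eta * (T' - t1) / 2.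
have a0 : 0 < a by rewrite divr_gt0// mulr_gt0// subr_gt0.
pose tau := T' + a / C; have aC : 0 < a / C by rewrite divr_gt0.
have Ttau : T' < tau by rewrite /tau; lra.
have tau0 : 0 < tau by lra.
pose uu (w : R * R) := u w - a / (tau - w.1).
pose vv (w : R * R) := - v w.
pose M0 := uu (t1, x1) + vv (t1, x1).
have M0p : 0 < M0.
  have : a / (tau - t1) < eta.
    rewrite ltr_pdivrMr; last by lra.
    have : 0 < eta * (T' - t1) by rewrite mulr_gt0// subr_gt0.
    have : 0 < eta * (a / C) by rewrite mulr_gt0.
    rewrite /a /tau; set z := _ / C; nra.
  by rewrite /M0 /uu /vv /=; move: eta0; rewrite /eta; lra.
have pos w : K w -> 0 < a / (tau - w.1).
  by move=> [/andP[_ wT] _]; rewrite divr_gt0//; lra.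
have uscuu : usc_within K uu.
  apply: usc_withinD; first exact: usc_within_subset KD uscu.
  apply: usc_within_continuous => w Kw.
  apply: continuousN; apply: continuousM; first exact: cst_continuous.
  apply: continuousV; first by have [/andP[_ wT] _] := Kw; rewrite gt_eqF//; lra.
  by apply: continuousB; [exact: cst_continuous|exact: cvg_fst].
have uscvv : usc_within K vv by exact: usc_within_subset KD uscv.
(* The whole boundary of [K], the side [t = T'] included, written as degenerate boxes so that
   compactness is immediate. *)
pose B := [set w : R * R | 0 <= w.1 <= 0 /\ 0 <= w.2 <= m] `|`
  [set w : R * R | T' <= w.1 <= T' /\ 0 <= w.2 <= m] `|`
  [set w : R * R | 0 <= w.1 <= T' /\ 0 <= w.2 <= 0] `|`
  [set w : R * R | 0 <= w.1 <= T' /\ m <= w.2 <= m].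
have cB : compact B by do 3?apply: compactU; exact: compact_box.
have BP w : B w <-> K w /\ [\/ w.1 = 0, w.1 = T', w.2 = 0 | w.2 = m].
  split.
    move=> [[[]|]|] /= [/andP[? ?] /andP[? ?]]; (split; first by split => /=; lra).
    - by constructor 1; lra.
    - by constructor 2; lra.
    - by constructor 3; lra.
    - by constructor 4; lra.
  move=> [[/andP[? ?] /andP[? ?]] []] => w0.
  - by do 3!left; split => /=; lra.
  - by do 2!left; right; split => /=; lra.
  - by left; right; split => /=; lra.
  - by right; split => /=; lra.
have Bneg w : B w -> uu w + vv w < M0.
  move=> /BP[Kw wB]; apply: (le_lt_trans _ M0p); rewrite /uu /vv.
  have := pos _ Kw; have := bnd w (KD _ Kw).
  case: wB => wB.
  - by move=> /(_ (or_introl wB)); lra.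
  - move=> _ _; have := uC _ _ Kw Kw.
    have -> : a / (tau - w.1) = C.
      by rewrite wB /tau addrAC subrr add0r invf_div mulrC divfK// gt_eqF.
    lra.
  - by move=> /(_ (or_intror (or_introl wB))); lra.
  - by move=> /(_ (or_intror (or_intror wB))); lra.
have BK : B `<=` K by move=> w /BP[].
have [d d0 dB] := usc_within_near_diagonal cB BK uscuu uscvv Bneg.
(* At the doubling maximum the penalty is less than [C], so the squared distance of the two points
   is below [4 * e * C], half of [d ^+ 2]. *)
pose e := d ^+ 2 / (8 * C).
have dd : 0 < d ^+ 2 by rewrite exprn_gt0.
have e0 : 0 < e by rewrite divr_gt0// mulr_gt0.
have c1 w : {for w, continuous (fun w : (R * R) * (R * R) =>
    ((w.1.1 - w.2.1) ^+ 2 + (w.1.2 - w.2.2) ^+ 2) / (4 * e))}.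
  apply: continuousM; last exact: cst_continuous.
  have f11 : {for w, continuous (fun w : (R * R) * (R * R) => w.1.1)}.
    exact: (cvg_comp _ _ cvg_fst cvg_fst).
  have f12 : {for w, continuous (fun w : (R * R) * (R * R) => w.1.2)}.
    exact: (cvg_comp _ _ cvg_fst cvg_snd).
  have f21 : {for w, continuous (fun w : (R * R) * (R * R) => w.2.1)}.
    exact: (cvg_comp _ _ cvg_snd cvg_fst).
  have f22 : {for w, continuous (fun w : (R * R) * (R * R) => w.2.2)}.
    exact: (cvg_comp _ _ cvg_snd cvg_snd).
  by apply: continuousD; apply: continuous_sqr; apply: continuousB.
have [||[[a1 b1] [a2 b2]] [/= Ks1 Ks2] dmax] := @compact_usc_max R _ (K `*` K)
    (fun w => uu w.1 + vv w.2 - ((w.1.1 - w.2.1) ^+ 2 + (w.1.2 - w.2.2) ^+ 2) / (4 * e))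
    (compact_setX cK cK).
- by exists ((t1, x1), (t1, x1)).
- apply: usc_withinD.
    by apply: usc_withinD; [exact: usc_within_fst|exact: usc_within_snd].
  by apply: usc_within_continuous => w _; apply: continuousN; exact: c1.
have dM0 := dmax ((t1, x1), (t1, x1)) (conj K1 K1).
rewrite /= !subrr expr0n /= addr0 mul0r subr0 -/M0 in dM0.
have e4 : 0 < 4 * e by rewrite mulr_gt0.
have uuC : uu (a1, b1) + vv (a2, b2) < C.
  by have := uC _ _ Ks1 Ks2; have := pos _ Ks1; rewrite /uu /vv /=; lra.
have dist : (a1 - a2) ^+ 2 + (b1 - b2) ^+ 2 < d ^+ 2.
  have : ((a1 - a2) ^+ 2 + (b1 - b2) ^+ 2) / (4 * e) < C by lra.
  rewrite ltr_pdivrMr// (_ : C * (4 * e) = d ^+ 2 / 2); last first.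
    by rewrite /e; field; rewrite gt_eqF.
  lra.
have near1 : `|a1 - a2| < d.
  rewrite -(ltr_pXn2r (n := 2))// ?nnegrE ?ltW//; rewrite real_normK ?num_real//.
  by have := sqr_ge0 (b1 - b2); lra.
have near2 : `|b1 - b2| < d.
  rewrite -(ltr_pXn2r (n := 2))// ?nnegrE ?ltW//; rewrite real_normK ?num_real//.
  by have := sqr_ge0 (a1 - a2); lra.
have quot0 : 0 <= ((a1 - a2) ^+ 2 + (b1 - b2) ^+ 2) / (4 * e).
  by rewrite divr_ge0 ?addr_ge0 ?sqr_ge0// ltW.
have nB1 : ~ B (a1, b1).
  by move=> Bs; have [] := dB _ _ Bs Ks2 near1 near2; lra.
have nB2 : ~ B (a2, b2).
  move=> Bs; have [] := dB _ _ Bs Ks1; rewrite /= ?[`|_ - a1|]distrC ?[`|_ - b1|]distrC//.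
  by lra.
have inner s y : K (s, y) -> ~ B (s, y) -> [/\ 0 < s, s < T', 0 < y & y < m].
  move=> Ksy nB; have [/= /andP[s0 sT] /andP[y0 ym]] := Ksy.
  split; rewrite lt_neqAle ?s0 ?sT ?y0 ?ym andbT; apply/eqP => E; apply: nB; apply/BP;
    split => //=.
  - by constructor 1.
  - by constructor 2.
  - by constructor 3.
  - by constructor 4.
have ball s y : [/\ 0 < s, s < T', 0 < y & y < m] ->
    exists2 rho : R, 0 < rho & forall rho' k l, rho' <= rho -> `|k| < rho' -> `|l| < rho' ->
      K (s + k, y + l) /\ [/\ 0 < s + k, s + k < T', 0 < y + l & y + l < m].
  move=> [s0 sT y0 ym]; exists (Num.min (Num.min s (T' - s)) (Num.min y (m - y))).
    by rewrite !lt_min s0 y0 !subr_gt0 sT ym.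
  move=> rho' k l; rewrite !le_min => /andP[/andP[r1 r2] /andP[r3 r4]].
  rewrite !ltr_norml => /andP[k1 k2] /andP[l1 l2].
  by split; [split => /=; lra|split; lra].
have [rho1 rho10 in1] := ball _ _ (inner _ _ Ks1 nB1).
have [rho2 rho20 in2] := ball _ _ (inner _ _ Ks2 nB2).
pose rho := Num.min rho1 rho2; have rho0 : 0 < rho by rewrite lt_min rho10.
have [rr1 rr2] : rho <= rho1 /\ rho <= rho2 by rewrite !ge_min !lexx orbT.
pose c := Num.min (a / tau) (a / tau ^+ 2).
have c0 : 0 < c.
  by rewrite lt_min; apply/andP; split; apply: divr_gt0 => //; exact: exprn_gt0.
pose A t x := [/\ 0 < t, t < T', 0 < x & x < m].
pose H1 (w : R * R * R * R) := G (w.1.1.1 + c, w.1.1.2 + c, w.1.2, w.2).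
have sub1 : quadratic_subsolution H1 A (fun t x => uu (t, x)).
  by apply: (quadratic_sub_penalized A1 subu T'T a0 Ttau); rewrite ge_min lexx ?orbT.
have sub2 : quadratic_subsolution (mirror G) A (fun t x => vv (t, x)).
  move=> t x [? ? ? ?]; apply: subv; do 2?split => //=.
    by rewrite (lt_trans _ T'T)// lte_fin.
  by apply/andP.
have maxconv (w : R * R -> R) : usc_within K w ->
    forall t x, exists s : R * R, K (s.1, s.2) /\ forall a b, K (a, b) ->
    w (a, b) - ((t - a) ^+ 2 + (x - b) ^+ 2) / (2 * e) <=
    w (s.1, s.2) - ((t - s.1) ^+ 2 + (x - s.2) ^+ 2) / (2 * e).
  move=> uscw t x.
  have [|[s1 s2] Ks smax] := @compact_usc_max R _ K
    (fun s => w s - ((t - s.1) ^+ 2 + (x - s.2) ^+ 2) / (2 * e)) cK K0.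
    apply: usc_withinD => //; apply: usc_within_continuous => s _.
    apply: continuousN; apply: continuousM; last exact: cst_continuous.
    by apply: continuousD; apply: continuous_sqr; apply: continuousB;
      by [exact: cst_continuous|exact: cvg_fst|exact: cvg_snd].
  by exists (s1, s2); split => // a' b' Kab; exact: (smax (a', b')).
apply: (@no_interior_doubling_max R H1 (mirror G) (fun t x => K (t, x)) A
  (fun t x => uu (t, x)) (fun t x => vv (t, x)) e rho a1 b1 a2 b2) => //.
- move=> w; apply: (@continuous_comp _ _ _ (fun w : R * R * R * R =>
    (w.1.1.1 + c, w.1.1.2 + c, w.1.2, w.2)) G); last exact: cG.
  have [h1 h2 h3 h4] := continuous_coordinates4 w.
  by apply: continuous_quadruple => //; apply: continuousD => //; exact: cst_continuous.
- exact: mirror_continuous.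
- by move=> z al p q q' qq; exact: A0.
- exact: maxconv.
- exact: maxconv.
- by move=> k l kr lr; exact: (in1 rho).
- by move=> k l kr lr; exact: (in2 rho).
- by move=> s y s' y' Ksy Ksy'; exact: (dmax ((s, y), (s', y')) (conj Ksy Ksy')).
(* Both arguments of (A1) increase strictly: the time slope by [c], the value because [uu + vv] is
   positive at the maximum. *)
- move=> q; rewrite /H1 /mirror /= !opprK subr_gt0.
  apply: (A1 _ _ _ _ _ _).2; last by lra.
  have : 0 < uu (a1, b1) + vv (a2, b2) by lra.
  rewrite /vv /=; lra.
Qed.

End ComparisonPrinciple.

(** * Test functions *)

Section TestFunctions.
Context {R : realType}.
Implicit Types (A : set (R * R)) (u phi psi : R * R -> R) (w : R * R).

Lemma upper_semicontinuous_onP A u :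
  upper_semicontinuous_on A u <-> usc_within A u.
Proof.
rewrite /upper_semicontinuous_on /lower_semicontinuous_on; split.
  move=> lsc w M Aw uM; have [|V nV Vu] := lsc w (- M).
    by rewrite /from_subspace lte_fin ltrN2.
  have : within A (nbhs w) V by rewrite nbhs_subspace_in.
  by apply: filterS => y /Vu; rewrite /from_subspace lte_fin ltrN2.
move=> usc w a; rewrite /from_subspace lte_fin ltrNr => uM.
have [Aw|nAw] := pselect (A w).
  exists [set y | A y /\ u y < - a]; last first.
    by move=> y [_]; rewrite lte_fin ltrNr.
  change (nbhs_subspace (w : subspace A) [set y | A y /\ u y < - a]).
  rewrite -nbhs_subspace_in//; apply: filterS (usc w _ Aw uM) => y uy Ay.
  by split => //; exact: uy.
(* Points outside [A] are isolated in the subspace topology. *)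
exists [set w]; last by move=> y ->; rewrite lte_fin ltrNr.
change (nbhs_subspace (w : subspace A) [set w]).
by rewrite -nbhs_subspace_out.
Qed.

Lemma open_slice_x A w : open A -> A w -> \forall x \near w.2, A (w.1, x).
Proof.
move=> oA Aw; have /near_box[r r0 rA] : \forall y \near w, A y by exact: open_nbhs_nbhs.
apply/nbhs_ballP; exists r => //= t; rewrite -ball_normE /ball_/= distrC => tr.
by apply: rA; rewrite //= subrr normr0.
Qed.

Lemma within_open_continuousP A (f g : R * R -> R) : open A -> {in A, f =1 g} ->
  {within A, continuous f} <-> (forall w, A w -> {for w, continuous g}).
Proof.
move=> oA fg; rewrite continuous_open_subspace//.
have near_fg w : A w -> \forall y \near w, f y = g y.
  move=> Aw; have : \forall y \near w, A y by exact: open_nbhs_nbhs.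
  by apply: filterS => y Ay; apply: fg; rewrite inE.
split=> cf w Aw.
  have := cf w; rewrite inE => /(_ Aw) cfw.
  have fgw : g w = f w by rewrite fg// inE.
  rewrite /prop_for /continuous_at fgw; apply: cvg_trans cfw.
  apply: near_eq_cvg; apply: filterS (near_fg w Aw) => y -> //.
rewrite inE in Aw; have fgw : f w = g w by rewrite fg// inE.
rewrite /prop_for /continuous_at fgw; apply: cvg_trans (cf w Aw).
by apply: near_eq_cvg; apply: filterS (near_fg w Aw) => y ->.
Qed.

(** [partial_xx phi] differentiates [partial_x phi], which is known to equal [fx] only on [A];
    openness makes the two agree near each point of a slice, which is all that a derivative sees. *)
Lemma test_function_intro A phi ft fx fxx : open A ->
  (forall w, A w -> [/\ is_derive w.1 1 (fun t => phi (t, w.2)) (ft w),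
     is_derive w.2 1 (fun x => phi (w.1, x)) (fx w) &
     is_derive w.2 1 (fun x => fx (w.1, x)) (fxx w)]) ->
  (forall w, A w -> [/\ {for w, continuous ft}, {for w, continuous fx} &
     {for w, continuous fxx}]) ->
  test_function A phi /\ (forall w, A w -> jet phi w = (ft w, fx w, fxx w)).
Proof.
move=> oA dphi cphi.
have Et : {in A, partial_t phi =1 ft}.
  move=> w; rewrite inE => /dphi[d1 _ _].
  by rewrite /partial_t derive1E; exact: derive_val.
have Ex : {in A, partial_x phi =1 fx}.
  move=> w; rewrite inE => /dphi[_ d1 _].
  by rewrite /partial_x derive1E; exact: derive_val.
have Exn w : A w -> \forall x \near w.2, fx (w.1, x) = partial_x phi (w.1, x).
  move=> Aw; apply: filterS (open_slice_x oA Aw) => x Ax.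
  by rewrite Ex// inE.
have dxx w : A w -> is_derive w.2 1 (fun x => partial_x phi (w.1, x)) (fxx w).
  move=> Aw; have [_ _ d2] := dphi w Aw.
  by apply: near_eq_is_derive d2; exact: Exn.
have Exx : {in A, partial_xx phi =1 fxx}.
  move=> w; rewrite inE => /dxx d2.
  by rewrite /partial_xx {1}/partial_x derive1E; exact: derive_val.
split; last by move=> w Aw; rewrite /jet Et ?inE// Ex ?inE// Exx ?inE.
split.
- by move=> w Aw; have [d1 d2 _] := dphi w Aw; have d3 := dxx w Aw; split; exact: ex_derive.
- by apply/(within_open_continuousP oA Et) => w /cphi[].
- by apply/(within_open_continuousP oA Ex) => w /cphi[].
- by apply/(within_open_continuousP oA Exx) => w /cphi[].
Qed.

Lemma test_function_elim A phi : open A -> test_function A phi ->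
  (forall w, A w -> [/\ is_derive w.1 1 (fun t => phi (t, w.2)) (partial_t phi w),
     is_derive w.2 1 (fun x => phi (w.1, x)) (partial_x phi w) &
     is_derive w.2 1 (fun x => partial_x phi (w.1, x)) (partial_xx phi w)]) /\
  (forall w, A w -> [/\ {for w, continuous (partial_t phi)},
     {for w, continuous (partial_x phi)} & {for w, continuous (partial_xx phi)}]).
Proof.
move=> oA [dphi ct cx cxx]; split => w Aw.
  have [d1 d2 d3] := dphi w Aw.
  split; [rewrite /partial_t|rewrite /partial_x|].
  - by rewrite derive1E; exact: (derivableP d1).
  - by rewrite derive1E; exact: (derivableP d2).
  - have -> : partial_xx phi w = 'D_1 (fun x => partial_x phi (w.1, x)) w.2.
      by rewrite -derive1E.
    exact: (derivableP d3).
have eqA (f : R * R -> R) : {in A, f =1 f} by [].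
by split; [move: ct|move: cx|move: cxx];
  move=> /(within_open_continuousP oA (eqA _)) cf; exact: cf.
Qed.

Lemma test_functionD A phi psi : open A -> test_function A phi -> test_function A psi ->
  test_function A (fun w => phi w + psi w) /\
  (forall w, A w -> jet (fun w => phi w + psi w) w =
   (partial_t phi w + partial_t psi w, partial_x phi w + partial_x psi w,
    partial_xx phi w + partial_xx psi w)).
Proof.
move=> oA /(test_function_elim oA)[d1 c1] /(test_function_elim oA)[d2 c2].
have addC (f g : R * R -> R) w : {for w, continuous f} -> {for w, continuous g} ->
    {for w, continuous (fun w => f w + g w)}.
  by move=> cf cg; exact: (continuousD cf cg).
apply: (@test_function_intro A (fun w => phi w + psi w)
  (fun w => partial_t phi w + partial_t psi w)
  (fun w => partial_x phi w + partial_x psi w)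
  (fun w => partial_xx phi w + partial_xx psi w)) => // w Aw.
  have [? ? ?] := d1 w Aw; have [? ? ?] := d2 w Aw.
  by split; exact: is_deriveD.
have [? ? ?] := c1 w Aw; have [? ? ?] := c2 w Aw.
by split; apply: addC.
Qed.

Lemma test_functionN A phi : open A -> test_function A phi ->
  test_function A (fun w => - phi w) /\ (forall w, A w -> jet (fun w => - phi w) w =
   (- partial_t phi w, - partial_x phi w, - partial_xx phi w)).
Proof.
move=> oA /(test_function_elim oA)[d1 c1].
have oppC (f : R * R -> R) w : {for w, continuous f} ->
    {for w, continuous (fun w => - f w)}.
  by move=> cf; exact: (continuousN cf).
apply: (@test_function_intro A (fun w => - phi w) (fun w => - partial_t phi w)
  (fun w => - partial_x phi w) (fun w => - partial_xx phi w)) => // w Aw.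
  by have [? ? ?] := d1 w Aw; split; exact: is_deriveN.
by have [? ? ?] := c1 w Aw; split; apply: oppC.
Qed.

Lemma test_function_poly A (f g : {poly R}) : open A ->
  test_function A (fun w => f.[w.1] + g.[w.2]) /\
  (forall w, A w -> jet (fun w => f.[w.1] + g.[w.2]) w =
    (f^`().[w.1], g^`().[w.2], g^`()^`().[w.2])).
Proof.
move=> oA.
apply: (@test_function_intro A _ (fun w => f^`().[w.1]) (fun w => g^`().[w.2])
  (fun w => g^`()^`().[w.2])) => // w Aw.
  split; last exact: is_derive_poly.
    rewrite -[f^`().[w.1]]addr0.
    exact: (is_deriveD (is_derive_poly f w.1) (is_derive_cst g.[w.2] w.1 1)).
  rewrite -[g^`().[w.2]]add0r.
  exact: (is_deriveD (is_derive_cst f.[w.1] w.2 1) (is_derive_poly g w.2)).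
have c1 (h : {poly R}) : {for w, continuous (fun w => h.[w.1])}.
  by apply: (@continuous_comp _ _ _ fst (horner h)); [exact: cvg_fst|exact: continuous_horner].
have c2 (h : {poly R}) : {for w, continuous (fun w => h.[w.2])}.
  by apply: (@continuous_comp _ _ _ snd (horner h)); [exact: cvg_snd|exact: continuous_horner].
by split.
Qed.

Lemma mirror_subsolution G A u : open A ->
  supersolution G A u <-> subsolution (mirror G) A (fun w => - u w).
Proof.
move=> oA; split=> -[sc jets]; split.
- by rewrite /upper_semicontinuous_on; under eq_fun do rewrite opprK.
- move=> w Aw a p q [phi [tphi phiw near_phi]] [<- <- <-].
  have [tN jN] := test_functionN oA tphi.
  rewrite /mirror /= oppr_le0 opprK; apply: (jets w Aw).
  exists (fun w => - phi w); last by rewrite jN.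
  split => //=; first by rewrite phiw opprK.
  by apply: filterS near_phi => y; rewrite /= lerNl.
- by move: sc; rewrite /upper_semicontinuous_on; under eq_fun do rewrite opprK.
- move=> w Aw a p q [phi [tphi phiw near_phi]] [<- <- <-].
  have [tN jN] := test_functionN oA tphi.
  have := jets w Aw (- partial_t phi w) (- partial_x phi w) (- partial_xx phi w).
  rewrite /mirror /= !opprK oppr_le0; apply.
  exists (fun w => - phi w); last by rewrite jN.
  split => //=; first by rewrite phiw.
  by apply: filterS near_phi => y; rewrite /= lerN2.
Qed.

Lemma subsolution_quadratic G A u : open A -> subsolution G A u ->
  quadratic_subsolution G (fun t x => A (t, x)) (fun t x => u (t, x)).
Proof.
move=> oA [_ jets] t x Atx a b p q r r0 touch.
pose f : {poly R} := (u (t, x))%:P + a%:P * ('X - t%:P) + b%:P * (('X - t%:P) * ('X - t%:P)).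
pose g : {poly R} := p%:P * ('X - x%:P) + (q / 2)%:P * (('X - x%:P) * ('X - x%:P)).
have he := (hornerXsubC, hornerD, hornerM, hornerC, horner_exp).
have [tf jf] := test_function_poly f g oA.
apply: (jets (t, x) Atx); exists (fun w => f.[w.1] + g.[w.2]).
  split => //.
    by rewrite /f /g /= !he !subrr; ring.
  apply/near_box; exists r => // -[s y] /= sr yr.
  have := touch _ _ sr yr; rewrite ![_ + (_ - _)]addrC !subrK /f /g !he.
  by congr (_ <= _); ring.
have dX c : ('X - c%:P : {poly R})^`() = 1%:P by rewrite derivXsubC polyC1.
rewrite jf// /f /g /= !(derivC, dX, derivD, derivM) !he ?horner0.
by rewrite !subrr; congr (_, _, _); field.
Qed.

End TestFunctions.

(** * Contact of test functions *)

Section JetComparison.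
(* Conversion would otherwise unfold the partial derivatives into limits, at great cost. *)
Local Opaque partial_t partial_x partial_xx.
Context {R : realType}.
Implicit Types (A : set (R * R)) (u phi psi : R * R -> R) (w y : R * R) (r e : R).

Definition box w r : set (R * R) := [set y | `|y.1 - w.1| < r /\ `|y.2 - w.2| < r].

Lemma nbhs_box w r : 0 < r -> nbhs w (box w r).
Proof. by move=> r0; apply/near_box; exists r. Qed.

Lemma nbhs_box_interior w r y : box w r y -> nbhs y (box w r).
Proof.
move=> [y1 y2]; apply/near_box.
exists (Num.min (r - `|y.1 - w.1|) (r - `|y.2 - w.2|)).
  by rewrite lt_min !subr_gt0 y1.
move=> z; rewrite !lt_min => /andP[z1 _] /andP[_ z2]; split.
  by have := ler_distD y.1 z.1 w.1; lra.
by have := ler_distD y.2 z.2 w.2; lra.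
Qed.

Lemma nbhs_subbox w (P : set (R * R)) : nbhs w P ->
  exists2 r : R, 0 < r & box w r `<=` P.
Proof. by move/near_box => [r r0 rP]; exists r => // y []; exact: rP. Qed.

Lemma box_subset w r e : r <= e -> box w r `<=` box w e.
Proof. by move=> re y [y1 y2]; split; lra. Qed.

Lemma mean_value_bound (f df : R -> R) (x y C : R) :
  (forall z : R, `|z - x| <= `|y - x| -> is_derive z 1 f (df z) /\ `|df z| <= C) ->
  `|f y - f x| <= C * `|y - x|.
Proof.
move=> fC; have dist z : (x <= z <= y) \/ (y <= z <= x) -> `|z - x| <= `|y - x|.
  move=> [/andP[xz zy]|/andP[yz zx]].
    by rewrite !ger0_norm; lra.
  by rewrite !ler0_norm; lra.
have itv (a b z : R) : z \in `]a, b[ -> a <= z <= b.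
  by rewrite in_itv /= => /andP[az zb]; rewrite !ltW.
have itvc (a b z : R) : z \in `[a, b] -> a <= z <= b by rewrite in_itv.
have cont (a b : R) : (forall z : R, a <= z <= b -> is_derive z 1 f (df z)) ->
    {within `[a, b], continuous f}.
  move=> dab; apply: derivable_within_continuous => z /itvc zab.
  by have dz := dab z zab; exact: ex_derive.
have [xy|xy|->] := ltgtP x y; last by rewrite !subrr normr0 mulr0.
  have dz (z : R) : x <= z <= y -> is_derive z 1 f (df z).
    by move=> zxy; apply: (fC z _).1; apply: dist; left.
  have [|z zxy ->] := MVT xy (fun z h => dz z (itv _ _ _ h)); first exact: cont.
  by rewrite normrM ler_wpM2r//; apply: (fC z _).2; apply: dist; left; exact: itv.
have dz (z : R) : y <= z <= x -> is_derive z 1 f (df z).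
  by move=> zxy; apply: (fC z _).1; apply: dist; right.
have [|z zxy E] := MVT xy (fun z h => dz z (itv _ _ _ h)); first exact: cont.
rewrite distrC E (distrC y) normrM ler_wpM2r//.
by apply: (fC z _).2; apply: dist; right; exact: itv.
Qed.

(** Continuity of [phi] itself is not part of [test_function]. It follows from local bounds on the
    first partial derivatives, by moving first in t and then in x. *)
Lemma test_function_continuous A phi w : open A -> test_function A phi -> A w ->
  {for w, continuous phi}.
Proof.
move=> oA /(test_function_elim oA)[d c] Aw.
have [ct cx _] := c w Aw.
pose C := `|partial_t phi w| + `|partial_x phi w| + 1.
have C0 : 0 < C by rewrite /C; have := normr_ge0 (partial_t phi w);
  have := normr_ge0 (partial_x phi w); lra.
have nt : \forall y \near w, `|partial_t phi y| < C.
  apply: (cvgr_lt _ (cvg_norm ct)); rewrite /C.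
  by have := normr_ge0 (partial_x phi w); lra.
have nx : \forall y \near w, `|partial_x phi y| < C.
  apply: (cvgr_lt _ (cvg_norm cx)); rewrite /C.
  by have := normr_ge0 (partial_t phi w); lra.
have nA : \forall y \near w, A y by exact: open_nbhs_nbhs.
have [r r0 rP] := nbhs_subbox (filterI nA (filterI nt nx)).
apply/cvgrPdist_lt => e e0.
apply/near_box; exists (Num.min r (e / (2 * C))).
  by rewrite lt_min r0 divr_gt0// mulr_gt0.
move=> y; rewrite !lt_min => /andP[yr1 ye1] /andP[yr2 ye2].
have b1 : `|phi (y.1, w.2) - phi (w.1, w.2)| <= C * `|y.1 - w.1|.
  apply: (@mean_value_bound (fun t => phi (t, w.2)) (fun t => partial_t phi (t, w.2))).
  move=> z zy; have [Az [hz _]] : (A `&`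
      (fun y => `|partial_t phi y| < C /\ `|partial_x phi y| < C)) (z, w.2).
    by apply: rP; split => /=; [lra|rewrite subrr normr0].
  by have [dz _ _] := d _ Az; split; [exact: dz|exact: ltW].
have b2 : `|phi (y.1, y.2) - phi (y.1, w.2)| <= C * `|y.2 - w.2|.
  apply: (@mean_value_bound (fun x => phi (y.1, x)) (fun x => partial_x phi (y.1, x))).
  move=> z zy; have [Az [_ hz]] : (A `&`
      (fun y => `|partial_t phi y| < C /\ `|partial_x phi y| < C)) (y.1, z).
    by apply: rP; split => /=; lra.
  by have [_ dz _] := d _ Az; split; [exact: dz|exact: ltW].
have := ler_distD (phi (y.1, w.2)) (phi y) (phi w).
rewrite distrC; move: b1 b2; rewrite -!surjective_pairing => b1 b2 tri.
apply: (le_lt_trans tri).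
have h1 : C * `|y.1 - w.1| < e / 2.
  by rewrite mulrC -ltr_pdivlMr// -mulrA -invfM.
have h2 : C * `|y.2 - w.2| < e / 2.
  by rewrite mulrC -ltr_pdivlMr// -mulrA -invfM.
lra.
Qed.

(** If [ddf] were negative, [df] would be negative just to the right of [x], and the mean value
    theorem would give a smaller value of [f] there. *)
Lemma derive2_ge0_at_min (f df : R -> R) (ddf x r : R) : 0 < r ->
  (forall z : R, `|z - x| < r -> is_derive z 1 f (df z)) -> is_derive x 1 df ddf ->
  (forall z : R, `|z - x| < r -> f x <= f z) -> df x = 0 /\ 0 <= ddf.
Proof.
move=> r0 dfz ddfx minf.
have itv (z : R) : z \in `]x - r, x + r[ -> `|z - x| < r.
  by rewrite in_itv /= => /andP[? ?]; rewrite ltr_norml; lra.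
have df0 : df x = 0.
  have xitv : x \in `]x - r, x + r[ by rewrite in_itv /=; lra.
  have d0 : is_derive x 1 f 0.
    apply: (derive1_at_min _ _ xitv); first by lra.
      by move=> z /itv/dfz dz; exact: ex_derive.
    by move=> z /itv/minf.
  have d1 : is_derive x 1 f (df x) by apply: dfz; rewrite subrr normr0.
  by rewrite -(@derive_val _ _ _ _ _ _ _ d1) (@derive_val _ _ _ _ _ _ _ d0).
split=> //; rewrite leNgt; apply/negP => ddf0.
have /cvgrPdist_lt/(_ (- ddf)) := @ex_derive _ _ _ _ _ _ _ ddfx.
have -> : lim (h^-1 *: ((df \o shift x) (h *: 1) - df x) @[h --> 0^']) = ddf.
  exact: (@derive_val _ _ _ _ _ _ _ ddfx).
rewrite oppr_gt0 => /(_ ddf0)/nbhs_ballP[d /= d0 dP].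
pose h := Num.min (r / 2) (d / 2).
have h0 : 0 < h by rewrite lt_min !divr_gt0.
have hr : h < r by rewrite gt_min; apply/orP; left; lra.
have hd : h < d by rewrite gt_min; apply/orP; right; lra.
have dneg (z : R) : 0 < z -> z <= h -> df (x + z) < 0.
  move=> z0 zh; have := dP z; rewrite -ball_normE /ball_/= sub0r normrN gtr0_norm//.
  move=> /(_ (le_lt_trans zh hd)); rewrite gt_eqF// => /(_ isT).
  rewrite df0 subr0 [_%:A]mulr1 (addrC z) ltr_norml opprK ltrDl oppr_gt0.
  move=> /andP[zneg _].
  have : z * (z^-1 *: df (x + z)) < 0 by rewrite pmulr_rlt0.
  by rewrite /GRing.scale /= mulrA divff ?gt_eqF// mul1r.
have xh : x < x + h by lra.
have dz (z : R) : z \in `]x, (x + h)[ -> is_derive z 1 f (df z).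
  by rewrite in_itv /= => /andP[? ?]; apply: dfz; rewrite ltr_norml; lra.
have [|z zi] := MVT xh dz.
  apply: derivable_within_continuous => z; rewrite in_itv /= => /andP[? ?].
  have dz' : is_derive z 1 f (df z) by apply: dfz; rewrite ltr_norml; lra.
  exact: ex_derive.
have : f x <= f (x + h) by apply: minf; rewrite addrC addKr gtr0_norm.
move: zi; rewrite in_itv /= => /andP[z1 z2].
have dzn : df z < 0.
  by have := dneg (z - x); rewrite (addrC x) subrK; apply; lra.
have : df z * h < 0 by rewrite pmulr_llt0.
rewrite (_ : x + h - x = h); last by ring.
lra.
Qed.

Lemma jet_at_min A phi psi w : open A -> test_function A phi -> test_function A psi ->
  A w -> (\forall y \near w, phi w - psi w <= phi y - psi y) ->
  [/\ partial_t phi w = partial_t psi w, partial_x phi w = partial_x psi w &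
      partial_xx psi w <= partial_xx phi w].
Proof.
move=> oA /(test_function_elim oA)[d1 c1] /(test_function_elim oA)[d2 c2] Aw minw.
have nA : \forall y \near w, A y by exact: open_nbhs_nbhs.
have [r r0 rP] := nbhs_subbox (filterI nA minw).
have dt : partial_t phi w - partial_t psi w = 0.
  have in_t (z : R) : `|z - w.1| < r -> box w r (z, w.2).
    by move=> zr; split => //=; rewrite subrr normr0.
  have xitv : w.1 \in `]w.1 - r, w.1 + r[ by rewrite in_itv /=; lra.
  have itv (z : R) : z \in `]w.1 - r, w.1 + r[ -> box w r (z, w.2).
    rewrite in_itv /= => /andP[? ?]; apply: in_t; rewrite ltr_norml; lra.
  have der (z : R) : box w r (z, w.2) -> is_derive z 1 (fun t => phi (t, w.2) - psi (t, w.2))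
      (partial_t phi (z, w.2) - partial_t psi (z, w.2)).
    move=> /rP[Az _]; have [e1 _ _] := d1 _ Az; have [e2 _ _] := d2 _ Az.
    exact: (is_deriveB e1 e2).
  have d0 : is_derive w.1 1 (fun t => phi (t, w.2) - psi (t, w.2)) 0.
    apply: (derive1_at_min _ _ xitv); first by lra.
      by move=> z /itv/der dz; exact: ex_derive.
    by move=> z /itv/rP[_]; rewrite -surjective_pairing.
  have d3 := der w.1 (itv _ xitv).
  rewrite -surjective_pairing in d3.
  by rewrite -(@derive_val _ _ _ _ _ _ _ d3) (@derive_val _ _ _ _ _ _ _ d0).
have [dx dxx] : partial_x phi w - partial_x psi w = 0 /\
    0 <= partial_xx phi w - partial_xx psi w.
  have in_x (z : R) : `|z - w.2| < r -> box w r (w.1, z).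
    by move=> zr; split => //=; rewrite subrr normr0.
  have := @derive2_ge0_at_min (fun x => phi (w.1, x) - psi (w.1, x))
    (fun x => partial_x phi (w.1, x) - partial_x psi (w.1, x))
    (partial_xx phi w - partial_xx psi w) w.2 r r0.
  rewrite /= -surjective_pairing; apply.
  - move=> z /in_x/rP[Az _]; have [_ e1 _] := d1 _ Az; have [_ e2 _] := d2 _ Az.
    exact: (is_deriveB e1 e2).
  - have [_ _ e1] := d1 _ Aw; have [_ _ e2] := d2 _ Aw.
    exact: (is_deriveB e1 e2).
  - by move=> z /in_x/rP[_].
by split; [apply/eqP; rewrite -subr_eq0 dt|apply/eqP; rewrite -subr_eq0 dx|rewrite -subr_ge0].
Qed.

Lemma strict_test_function A w : open A -> A w -> exists beta : R * R -> R,
  [/\ test_function A beta, jet beta w = (0, 0, 0), beta w = 0,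
      forall y, 0 <= beta y &
      forall r, 0 < r -> exists2 k : R, 0 < k & forall y, ~ box w r y -> k <= beta y].
Proof.
move=> oA Aw.
(* The fourth power in x makes the second x-derivative vanish at [w] as well. *)
pose f : {poly R} := ('X - w.1%:P) * ('X - w.1%:P).
pose s : {poly R} := ('X - w.2%:P) * ('X - w.2%:P).
pose g : {poly R} := s * s.
have [tb jb] := test_function_poly f g oA.
have he := (hornerXsubC, hornerD, hornerM, hornerC).
have dX (c : R) : ('X - c%:P)^`() = 1%:P by rewrite derivXsubC polyC1.
have bE y : f.[y.1] + g.[y.2] = (y.1 - w.1) ^+ 2 + (y.2 - w.2) ^+ 4.
  by rewrite /f /g /s !he; ring.
exists (fun w => f.[w.1] + g.[w.2]); split => //.
- rewrite jb// /f /g /s !(derivC, dX, derivD, derivM) !he.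
  by rewrite !subrr; congr (_, _, _); ring.
- by rewrite bE !subrr !expr0n addr0.
- move=> y; rewrite bE addr_ge0 ?sqr_ge0//.
  by have := sqr_ge0 ((y.2 - w.2) ^+ 2); rewrite -exprM.
- move=> r r0; exists (Num.min (r ^+ 2) (r ^+ 4)); first by rewrite lt_min !exprn_gt0.
  move=> y nbox; rewrite bE.
  have s4 : 0 <= (y.2 - w.2) ^+ 4 by have := sqr_ge0 ((y.2 - w.2) ^+ 2); rewrite -exprM.
  have s2 := sqr_ge0 (y.1 - w.1).
  have [y1|y1] := ltP `|y.1 - w.1| r; last first.
    rewrite ge_min; apply/orP; left.
    have : r ^+ 2 <= `|y.1 - w.1| ^+ 2 by rewrite lerXn2r// ?nnegrE// ltW.
    by rewrite real_normK ?num_real//; lra.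
  have y2 : r <= `|y.2 - w.2| by rewrite leNgt; apply/negP => y2; exact: nbox.
  rewrite ge_min; apply/orP; right.
  have : r ^+ 4 <= `|y.2 - w.2| ^+ 4 by rewrite lerXn2r// ?nnegrE// ltW.
  by rewrite (exprM `|_| 2 2) real_normK ?num_real// -exprM; lra.
Qed.

(** Makes the contact strict without changing the jet at [w]. The gap [k] outside a box keeps maxima
    inside it. *)
Lemma strict_test_above A phi w : open A -> test_function A phi -> A w ->
  exists psi : R * R -> R,
  [/\ test_function A psi, [/\ partial_t psi w = partial_t phi w,
        partial_x psi w = partial_x phi w & partial_xx psi w = partial_xx phi w],
      psi w = phi w,
      forall y, phi y <= psi y &
      forall r, 0 < r -> exists2 k : R, 0 < k & forall y, ~ box w r y -> phi y + k <= psi y].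
Proof.
move=> oA tphi Aw; have [beta [tb jb bw b0 bfar]] := strict_test_function oA Aw.
have [tpsi jpsi] := test_functionD oA tphi tb.
exists (fun w => phi w + beta w); split; first exact: tpsi.
- move: jb (jpsi w Aw); rewrite /jet => -[-> -> ->] [-> -> ->].
  by rewrite !addr0.
- by rewrite bw addr0.
- by move=> y; rewrite lerDl.
- move=> r /bfar[k k0 kP]; exists k => // y /kP.
  by rewrite lerD2l.
Qed.

Lemma strict_test_below A phi w : open A -> test_function A phi -> A w ->
  exists psi : R * R -> R,
  [/\ test_function A psi, [/\ partial_t psi w = partial_t phi w,
        partial_x psi w = partial_x phi w & partial_xx psi w = partial_xx phi w],
      psi w = phi w,
      forall y, psi y <= phi y &
      forall r, 0 < r -> exists2 k : R, 0 < k & forall y, ~ box w r y -> psi y + k <= phi y].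
Proof.
move=> oA tphi Aw; have [beta [tb jb bw b0 bfar]] := strict_test_function oA Aw.
have [tnb jnb] := test_functionN oA tb.
have [tpsi jpsi] := test_functionD oA tphi tnb.
exists (fun w => phi w + - beta w); split; first exact: tpsi.
- move: jb (jnb w Aw) (jpsi w Aw); rewrite /jet => -[-> -> ->] [-> -> ->] [-> -> ->].
  by rewrite !oppr0 !addr0.
- by rewrite bw subr0.
- by move=> y; rewrite gerDl oppr_le0.
- move=> r /bfar[k k0 kP]; exists k => // y /kP.
  by rewrite -addrA gerDl addrC subr_le0.
Qed.

(** The value [z'] is not tied to [psi]: it will be that of a competing subsolution, or of a lifted
    [psi]. *)
Lemma jet_inequality_near (G : R * R * R * R -> R) A psi w (z : R) :
  continuous G -> open A -> test_function A psi -> A w ->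
  0 < G (z, partial_t psi w, partial_x psi w, partial_xx psi w) ->
  exists2 r : R, 0 < r & exists2 e : R, 0 < e & forall y, box w r y -> A y /\
    forall z', `|z' - z| < e ->
      0 < G (z', partial_t psi y, partial_x psi y, partial_xx psi y).
Proof.
move=> cG oA /(test_function_elim oA)[_ c] Aw G0.
have [ct cx cxx] := c w Aw.
have [e e0 eG] := continuous4_pos (cG _) G0.
have near_e (f : R * R -> R) : {for w, continuous f} -> \forall y \near w, `|f y - f w| < e.
  move=> cf; have /cvgrPdist_lt/(_ e e0) := cf.
  by apply: filterS => y; rewrite distrC.
have nA : \forall y \near w, A y by exact: open_nbhs_nbhs.
have [r r0 rP] := nbhs_subbox (filterI nA (filterI (near_e _ ct)
  (filterI (near_e _ cx) (near_e _ cxx)))).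
exists r; first exact: r0.
exists e; first exact: e0.
move=> y /rP[Ay [h1 [h2 h3]]]; split; first exact: Ay.
by move=> z' zz; exact: (eG _ _ _ _ zz h1 h2 h3).
Qed.

End JetComparison.

(** * Perron's method *)

Section Perron.
Local Opaque partial_t partial_x partial_xx.
Context {R : realType}.
Variables (G : R * R * R * R -> R) (A : set (R * R)).
Hypotheses (cG : continuous G) (oA : open A).
Implicit Types (u v phi : R * R -> R) (w y : R * R) (r e : R).

Lemma compact_closed_box w r :
  compact [set y : R * R | `|y.1 - w.1| <= r /\ `|y.2 - w.2| <= r].
Proof.
have -> : [set y : R * R | `|y.1 - w.1| <= r /\ `|y.2 - w.2| <= r] =
    [set y | w.1 - r <= y.1 <= w.1 + r /\ w.2 - r <= y.2 <= w.2 + r].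
  apply/seteqP; split => y /=; rewrite !ler_norml.
    by move=> [/andP[? ?] /andP[? ?]]; split; lra.
  by move=> [/andP[? ?] /andP[? ?]]; split; lra.
exact: compact_box.
Qed.

(** If a strict test function [psi] above [U] violates the inequality at [w], a member of [S] that
    comes close to [U w] near [w] is touched by a vertical translate of [psi] in a small box, where
    the violation persists. *)
Lemma perron_sup (S : set (R * R -> R)) U :
  (forall v, S v -> subsolution G A v) ->
  (forall v y, S v -> A y -> v y <= U y) -> usc_within A U ->
  (forall w r e, A w -> 0 < r -> 0 < e ->
    exists v y, [/\ S v, A y, box w r y & U w - e < v y]) ->
  subsolution G A U.
Proof.
move=> subS SU uscU approx; split; first exact/upper_semicontinuous_onP.
move=> w Aw a p q [phi [tphi phiw near_phi]] [<- <- <-].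
rewrite leNgt; apply/negP => G0.
have [psi [tpsi [e1 e2 e3] psiw phipsi bfar]] := strict_test_above oA tphi Aw.
rewrite phiw in psiw.
have [r1 r10 [e e0 eG]] : exists2 r : R, 0 < r & exists2 e : R, 0 < e &
    forall y, box w r y -> A y /\ forall z', `|z' - U w| < e ->
      0 < G (z', partial_t psi y, partial_x psi y, partial_xx psi y).
  by apply: (jet_inequality_near cG oA tpsi Aw); rewrite e1 e2 e3; exact: G0.
clear G0 e1 e2 e3.
have cpsi := test_function_continuous oA tpsi Aw.
have npsi : \forall y \near w, `|psi y - U w| < e / 2.
  have /cvgrPdist_lt/(_ (e / 2)) := cpsi; rewrite divr_gt0// => /(_ isT).
  by apply: filterS => y; rewrite distrC psiw.
have [r2 r20 r2P] := nbhs_subbox (filterI near_phi npsi).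
pose r : R := Num.min r1 r2 / 2.
have r0 : 0 < r by rewrite divr_gt0// lt_min r10.
have inr y : `|y.1 - w.1| <= r -> `|y.2 - w.2| <= r -> box w r1 y /\ box w r2 y.
  have rm : r < Num.min r1 r2.
    have : 0 < Num.min r1 r2 by rewrite lt_min r10.
    by rewrite /r; lra.
  by move: rm; rewrite lt_min => /andP[? ?] ? ?; split; split; lra.
have [k k0 kP] := bfar r r0.
(* [d < k] keeps the maximum of [v - psi] in the open box; [d <= e / 2] keeps the value of [v] there
   within [e] of [U w]. *)
pose d : R := Num.min k e / 2.
have d0 : 0 < d by rewrite divr_gt0// lt_min k0.
have [dk de] : d < k /\ d < e.
  have : d < Num.min k e by rewrite /d ltr_pdivrMr// ltr_pMr ?ltr1n// lt_min k0.
  by rewrite lt_min => /andP.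
have npsi2 : \forall y \near w, psi y < U w + d / 2.
  by apply: (cvgr_lt _ cpsi); rewrite psiw ltrDl divr_gt0.
have [r3 r30 r3P] := nbhs_subbox npsi2.
have [v [y0 [Sv Ay0 y0box vy0]]] : exists v y, [/\ S v, A y,
    box w (Num.min r r3) y & U w - d / 2 < v y].
  by apply: approx => //; [rewrite lt_min r0|rewrite divr_gt0].
pose B := [set y : R * R | `|y.1 - w.1| <= r /\ `|y.2 - w.2| <= r].
have BA : B `<=` A by move=> y [y1 y2]; apply: (eG y (inr y y1 y2).1).1.
have [uscv jetv] := subS v Sv.
have By0 : B y0.
  case: y0box; rewrite !lt_min => /andP[y1 _] /andP[y2 _].
  by split; exact: ltW.
have [||y1 By1 maxv] :=
  @compact_usc_max R _ B (fun y => v y - psi y) (@compact_closed_box _ _).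
- by exists y0.
- apply: usc_withinD; first exact/(usc_within_subset BA)/upper_semicontinuous_onP.
  apply: usc_within_continuous => y By.
  by apply: continuousN; exact: test_function_continuous (BA _ By).
have Ay1 := BA _ By1.
have vd : - d < v y1 - psi y1.
  have := maxv y0 By0.
  have : psi y0 < U w + d / 2.
    apply: r3P; case: y0box; rewrite !lt_min => /andP[_ ?] /andP[_ ?].
    by split.
  lra.
have [y1r1 y1r2] := inr _ By1.1 By1.2.
have [phi1 psi1] := r2P _ y1r2.
have vU := SU v y1 Sv Ay1.
have y1in : box w r y1.
  apply: contrapT => /kP kb.
  lra.
have [tc jc] := test_function_poly (v y1 - psi y1)%:P 0 oA.
have [tpc jpc] := test_functionD oA tpsi tc.
have : G (v y1, partial_t psi y1, partial_x psi y1, partial_xx psi y1) <= 0.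
  apply: (jetv y1 Ay1).
  exists (fun w => psi w + ((v y1 - psi y1)%:P.[w.1] + (0 : {poly R}).[w.2])).
    split => //; first by rewrite hornerC horner0; ring.
    apply: filterS (nbhs_box_interior y1in) => y [hy1 hy2].
    have := maxv y (conj (ltW hy1) (ltW hy2)); rewrite hornerC horner0; lra.
  rewrite jpc//; have := jc y1 Ay1; rewrite /jet => -[-> -> ->].
  by rewrite !derivC !horner0 !addr0.
apply/negP; rewrite -ltNge; apply: (eG y1 y1r1).2.
have vpsi : v y1 - psi y1 <= 0.
  by have := phipsi y1; lra.
by move: psi1; rewrite !ltr_norml => /andP[? ?]; have : d <= e / 2;
  [rewrite /d ler_pM2r// ge_min lexx orbT|lra].
Qed.

Hypothesis A0 : cond_A0 G.

(** [L] is in effect the lower envelope of [u]. If it failed the inequality at [w], the maximum of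
    [u] and a slightly lifted test function would be a subsolution below [up] exceeding [u]
    somewhere. *)
Lemma perron_bump u up L :
  subsolution G A u -> supersolution G A up ->
  (forall y, A y -> L y <= u y) -> (forall y, A y -> L y <= up y) ->
  usc_within A (fun y => - L y) ->
  (forall w r e, A w -> 0 < r -> 0 < e ->
    exists y, [/\ A y, box w r y & u y < L w + e]) ->
  (forall y, A y -> u y <= up y) ->
  (forall v, subsolution G A v -> (forall y, ~ A y -> v y = u y) ->
    (forall y, A y -> u y <= v y <= up y) -> forall y, A y -> v y <= u y) ->
  supersolution G A L.
Proof.
move=> [uscu jetu] [lscup jetup] Lu Lup lscL approx uup maxu; split.
  suff : upper_semicontinuous_on A (fun y => - L y).
    by rewrite /upper_semicontinuous_on; under eq_fun do rewrite opprK.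
  exact/upper_semicontinuous_onP.
move=> w Aw a p q [phi [tphi phiw near_phi]] [<- <- <-].
have nA : \forall y \near w, A y by exact: open_nbhs_nbhs.
rewrite leNgt; apply/negP => G0.
(* Where [L] meets [up] there is no room for a bump, but then [phi] touches the supersolution [up]
   from below. *)
have [upL|Lupw] := leP (up w) (L w).
  have upw : up w = L w by apply/eqP; rewrite eq_le upL Lup.
  move: G0 phiw; rewrite -upw => G0 phiw; move: G0; apply/negP.
  rewrite -leNgt; apply: (jetup w Aw).
  exists phi; last exact: erefl.
  split; [exact: tphi|exact: phiw|].
  by apply: filterS2 nA near_phi => y Ay py; exact: le_trans (Lup y Ay).
have [psi [tpsi [e1 e2 e3] psiw phipsi bfar]] := strict_test_below oA tphi Aw.
rewrite phiw in psiw.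
have cNG : continuous (fun z => - G z) by move=> z; apply: continuousN; exact: cG.
have [r1 r10 [e e0 eG]] : exists2 r : R, 0 < r & exists2 e : R, 0 < e &
    forall y, box w r y -> A y /\ forall z', `|z' - L w| < e ->
      0 < - G (z', partial_t psi y, partial_x psi y, partial_xx psi y).
  by apply: (jet_inequality_near cNG oA tpsi Aw); rewrite e1 e2 e3 oppr_gt0; exact: G0.
clear G0 e1 e2 e3.
have cpsi := test_function_continuous oA tpsi Aw.
pose g : R := (up w - L w) / 4; have g0 : 0 < g by rewrite divr_gt0// subr_gt0.
pose h : R := Num.min (e / 2) g; have h0 : 0 < h by rewrite lt_min divr_gt0.
have npsi : \forall y \near w, `|psi y - L w| < h.
  have /cvgrPdist_lt/(_ h h0) := cpsi.
  by apply: filterS => y; rewrite distrC psiw.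
have uscup : usc_within A (fun y => - up y).
  apply/upper_semicontinuous_onP; rewrite /upper_semicontinuous_on.
  by under eq_fun do rewrite opprK.
have nup : \forall y \near w, A y -> - up y < - up w + g.
  by apply: uscup => //; rewrite ltrDl.
have [r2 r20 r2P] := nbhs_subbox (filterI (filterI near_phi npsi) nup).
pose r : R := Num.min r1 r2.
have r0 : 0 < r by rewrite lt_min r10.
have inr y : box w r y -> [/\ A y, phi y <= L y, `|psi y - L w| < h, up w - g < up y &
     forall z', `|z' - L w| < e ->
      G (z', partial_t psi y, partial_x psi y, partial_xx psi y) < 0].
  move=> yr.
  have y1 : box w r1 y by apply: box_subset yr; rewrite ge_min lexx.
  have y2 : box w r2 y by apply: box_subset yr; rewrite ge_min lexx orbT.
  have [Ay hG] := eG y y1; have [[py hy] uy] := r2P y y2.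
  split => //; first by have := uy Ay; lra.
  by move=> z' /hG; rewrite oppr_gt0.
have r2' : 0 < r / 2 by rewrite divr_gt0.
have [k k0 kP] := bfar _ r2'.
(* Off the half box [psi + d] stays below [phi], hence below [u], so the bump is glued without a
   seam. As [g] is a quarter of the gap, [psi + d < L w + 2 * g] while [up] exceeds [L w + 3 * g];
   and [h + d <= e] keeps the lifted values where [G] is negative. *)
pose d : R := Num.min h (k / 2).
have d0 : 0 < d by rewrite lt_min h0 divr_gt0.
have [dh dk] : d <= h /\ d <= k / 2.
  by split; rewrite [d <= _]ge_min lexx ?orbT.
have [he hg] : h <= e / 2 /\ h <= g.
  by split; rewrite [h <= _]ge_min lexx ?orbT.
pose inb y := (`|y.1 - w.1| < r) && (`|y.2 - w.2| < r).
have inbP y : reflect (box w r y) (inb y) by exact: andP.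
pose v y := if inb y then Num.max (u y) (psi y + d) else u y.
have uv y : u y <= v y by rewrite /v; case: ifP => // _; rewrite le_max lexx.
have far y : ~ box w (r / 2) y -> v y = u y.
  move=> yfar; rewrite /v; case: ifP => // /inbP yr; apply/max_idPl.
  have [Ay py _ _ _] := inr y yr; have := kP y yfar; have := Lu y Ay.
  lra.
have near_far y : ~ box w r y -> \forall y' \near y, v y' = u y'.
  move=> yfar; apply: filterS (nbhs_box y r2') => y' [h1 h2]; apply: far.
  move=> [h3 h4]; apply: yfar; split.
    by have := ler_distD y'.1 y.1 w.1; rewrite (distrC y.1 y'.1); lra.
  by have := ler_distD y'.2 y.2 w.2; rewrite (distrC y.2 y'.2); lra.
have subv : subsolution G A v.
  split.
    apply/upper_semicontinuous_onP => y M Ay vM.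
    have uscuy : \forall y' \near y, A y' -> u y' < M.
      have /upper_semicontinuous_onP := uscu.
      by apply => //; exact: le_lt_trans (uv y) vM.
    have [yr|yr] := pselect (box w r y); last first.
      by apply: filterS2 (near_far y yr) uscuy => y' ->.
    have cy := test_function_continuous oA tpsi Ay.
    have psiM : \forall y' \near y, psi y' < M - d.
      apply: (cvgr_lt _ cy); rewrite ltrBrDr; apply: le_lt_trans vM.
      by rewrite /v; move/inbP: yr => ->; rewrite le_max lexx orbT.
    apply: filterS2 uscuy psiM => y' uM pM Ay'; rewrite /v.
    case: ifP => // _; last exact: uM.
    by rewrite gt_max uM//=; lra.
  move=> y Ay a' p' q' [chi [tchi chiy near_chi]] [<- <- <-].
  have from_u : v y = u y -> G (v y, partial_t chi y, partial_x chi y, partial_xx chi y) <= 0.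
    move=> vu; rewrite vu; apply: (jetu y Ay); exists chi; last exact: erefl.
    split; [exact: tchi|by rewrite chiy|].
    by apply: filterS near_chi => y'; exact: le_trans.
  have [yr|yr] := pselect (box w r y); last first.
    by apply: from_u; rewrite /v; case: ifP => // /inbP.
  have [pu|up_] := leP (psi y + d) (u y).
    by apply: from_u; rewrite /v; case: ifP => // _; exact/max_idPl.
  have vy : v y = psi y + d.
    by rewrite /v; move/inbP: (yr) => ->; apply/max_idPr; exact: ltW.
  have [_ _ ph _ Gy] := inr y yr.
  (* [v] equals [psi + d] at [y] and is at least that nearby, so [chi - psi] has a local minimum at
     [y]; (A0) then passes from [chi] to [psi]. *)
  have [-> -> qq] : [/\ partial_t chi y = partial_t psi y,
      partial_x chi y = partial_x psi y & partial_xx psi y <= partial_xx chi y].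
    apply: (jet_at_min oA tchi tpsi Ay); rewrite chiy vy.
    apply: filterS2 near_chi (nbhs_box_interior yr) => y' cv /inbP yr'.
    have : psi y' + d <= v y' by rewrite /v yr' le_max lexx orbT.
    lra.
  apply: le_trans (A0 _ _ _ qq) _; clear qq; apply: ltW; apply: Gy; rewrite vy.
  by move: ph; rewrite !ltr_norml => /andP[? ?]; lra.
have vu : forall y, A y -> v y <= u y.
  apply: maxu => //.
    move=> y nAy; rewrite /v; case: ifP => // /inbP/inr[Ay]; contradiction.
  move=> y Ay; rewrite uv /v; case: ifP => [/inbP yr|_]; last exact: uup.
  have [_ _ ph upy _] := inr y yr; rewrite ge_max uup//=.
  move: ph; rewrite ltr_norml => /andP[_ ?].
  have : up w - L w = 4 * g by rewrite /g; field.
  lra.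
(* Near [w] the bump exceeds [L w + d / 2], whereas [u] comes below that value at some point. *)
have nd : \forall y \near w, psi w - d / 2 < psi y.
  by apply: (cvgr_gt _ cpsi); rewrite ltrBlDr ltrDl divr_gt0.
have [r3 r30 r3P] := nbhs_subbox nd.
have [y [Ay yb uy]] : exists y, [/\ A y, box w (Num.min r r3) y & u y < L w + d / 2].
  by apply: approx => //; [rewrite lt_min r0|rewrite divr_gt0].
have yr : box w r y by apply: box_subset yb; rewrite ge_min lexx.
have := r3P y; have yr3 : box w r3 y by apply: box_subset yb; rewrite ge_min lexx orbT.
move=> /(_ yr3) /=; have := vu y Ay.
rewrite /v; move/inbP: yr => ->; rewrite ge_max => /andP[_]; rewrite psiw; lra.
Qed.

End Perron.

(** * Real-valued semicontinuous envelopes *)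

Section Envelope.
Context {R : realType}.
Variable D : set (R * R).
Implicit Types (u v : R * R -> R) (w y : R * R) (r e M : R).

(** The infimum of the local upper bounds; local boundedness makes it finite, which avoids extended
    reals. *)
Definition usc_envelope u w : R :=
  inf [set M | exists2 r : R, 0 < r & forall y, D y -> box w r y -> u y <= M].

Variable u : R * R -> R.
Hypothesis bounded_u : forall w, D w -> exists M, exists2 r : R, 0 < r &
  forall y, D y -> box w r y -> u y <= M.

Let box_center w r : 0 < r -> box w r w.
Proof. by move=> r0; split; rewrite subrr normr0. Qed.

Let has_inf_bounds w : D w ->
  has_inf [set M | exists2 r : R, 0 < r & forall y, D y -> box w r y -> u y <= M].
Proof.
move=> Dw; split; first by have [M] := bounded_u Dw; exists M.
by exists (u w) => M [r r0]; apply => //; exact: box_center.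
Qed.

Lemma le_usc_envelope w : D w -> u w <= usc_envelope u w.
Proof.
move=> Dw; apply: lb_le_inf; first by have [] := has_inf_bounds Dw.
by move=> M [r r0]; apply => //; exact: box_center.
Qed.

Lemma usc_envelope_le w c : D w ->
  (forall M, c < M -> exists2 r : R, 0 < r & forall y, D y -> box w r y -> u y <= M) ->
  usc_envelope u w <= c.
Proof.
move=> Dw uc; apply/ler_addgt0Pr => e e0; apply: ge_inf.
  by have [] := has_inf_bounds Dw.
by apply: uc; rewrite ltrDl.
Qed.

Lemma usc_envelope_usc : usc_within D (usc_envelope u).
Proof.
move=> w M Dw uM; have e0 : 0 < M - usc_envelope u w by rewrite subr_gt0.
have [N [r r0 uN]] := inf_adherent e0 (has_inf_bounds Dw).
rewrite -/(usc_envelope u w) addrC subrK => NM.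
apply: filterS (nbhs_box w r0) => y yr Dy; apply: le_lt_trans NM.
apply: ge_inf; first by have [] := has_inf_bounds Dy.
have [d d0 dr] := nbhs_subbox (nbhs_box_interior yr).
by exists d => // z Dz /dr; exact: uN.
Qed.

Lemma usc_envelope_approx w r e : D w -> 0 < r -> 0 < e ->
  exists y, [/\ D y, box w r y & usc_envelope u w - e < u y].
Proof.
move=> Dw r0 e0; apply: contrapT => no.
have : usc_envelope u w <= usc_envelope u w - e.
  apply: ge_inf; first by have [] := has_inf_bounds Dw.
  exists r => // y Dy yr; rewrite leNgt; apply/negP => ey.
  by apply: no; exists y.
by lra.
Qed.

End Envelope.

Section SolutionTools.
Context {R : realType}.
Implicit Types (A D : set (R * R)) (u v : R * R -> R) (w y : R * R) (G : R * R * R * R -> R).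

Lemma subsolution_eq_on G A u v : open A -> (forall y, A y -> u y = v y) ->
  subsolution G A u -> subsolution G A v.
Proof.
move=> oA uv [/upper_semicontinuous_onP uscu jetu]; split.
  apply/upper_semicontinuous_onP => w M Aw; rewrite -uv// => /(uscu _ _ Aw).
  by apply: filterS => y uM Ay; rewrite -uv//; exact: uM.
move=> w Aw a p q [phi [tphi phiw near_phi] jphi]; rewrite -uv//.
apply: (jetu w Aw); exists phi; last exact: jphi.
split; [exact: tphi|by rewrite uv|].
have nA : \forall y \near w, A y by exact: open_nbhs_nbhs.
by apply: filterS2 nA near_phi => y Ay; rewrite uv.
Qed.

Lemma supersolution_eq_on G A u v : open A -> (forall y, A y -> u y = v y) ->
  supersolution G A u -> supersolution G A v.
Proof.
move=> oA uv /(mirror_subsolution _ _ oA) subu; apply/(mirror_subsolution _ _ oA).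
by apply: subsolution_eq_on subu => // y Ay; rewrite uv.
Qed.

Lemma usc_within_open A D u : open A -> usc_within A u ->
  (forall w M, D w -> ~ A w -> u w < M -> \forall y \near w, D y -> u y < M) ->
  usc_within D u.
Proof.
move=> oA uscu bd w M Dw uM; have [Aw|nAw] := pselect (A w); last exact: bd.
have nA : \forall y \near w, A y by exact: open_nbhs_nbhs.
by apply: filterS2 nA (uscu _ _ Aw uM) => y Ay + _; exact.
Qed.

Lemma usc_within_continuous_within D u : usc_within D u -> usc_within D (fun y => - u y) ->
  {within D, continuous u}.
Proof.
move=> usc lsc; apply/subspace_continuousP => w Dw; apply/cvgrPdist_lt => e e0.
have n1 := usc w (u w + e) Dw; have n2 := lsc w (- u w + e) Dw.
have /n1 {}n1 : u w < u w + e by rewrite ltrDl.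
have /n2 {}n2 : - u w < - u w + e by rewrite ltrDl.
apply: filterS2 n1 n2 => y h1 h2 Dy; rewrite ltr_norml.
by have := h1 Dy; have := h2 Dy; rewrite /from_subspace => ? ?; apply/andP; split; lra.
Qed.

Lemma continuous_within_usc D u : {within D, continuous u} -> usc_within D u.
Proof.
move=> /subspace_continuousP cu w M Dw uM.
have : \forall y \near within D (nbhs w), u y < M by exact: cvgr_lt (cu w Dw) _ uM.
by [].
Qed.

Lemma continuous_within_lsc D u : {within D, continuous u} ->
  usc_within D (fun y => - u y).
Proof.
move=> /subspace_continuousP cu w M Dw uM.
have uM' : - M < u w by lra.
have : \forall y \near within D (nbhs w), - M < u y by exact: cvgr_gt (cu w Dw) _ uM'.
by apply: filterS => y; lra.
Qed.

End SolutionTools.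

(** * Existence between a subsolution and a supersolution *)

Section Existence.
Context {R : realType}.
Variables (G : R * R * R * R -> R) (T : \bar R) (m : R).
Hypotheses (m0 : 0 < m) (cG : continuous G) (A0 : cond_A0 G) (A1 : cond_A1 G).
Hypothesis oA : open (Omega T m).
Implicit Types (u v : R * R -> R) (w y : R * R).

Let A := Omega T m.
Let D := slab T m.

Lemma Omega_sub_slab : Omega T m `<=` slab T m.
Proof. by move=> w [w1 [wT /andP[w2 w3]]]; do 2?split; rewrite ?ltW. Qed.

Lemma slab_not_Omega w : slab T m w -> (w.1 = 0 \/ w.2 = 0 \/ w.2 = m) <-> ~ Omega T m w.
Proof.
move=> [w1 [wT /andP[w2 w3]]]; split.
  by move=> h [a1 [_ /andP[a2 a3]]]; case: h => [|[|]] E; lra.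
move=> nO; apply: contrapT => /not_orP[n1 /not_orP[n2 n3]]; apply: nO.
split; [|split => //].
  by rewrite lt_neqAle w1 andbT; apply/eqP => E; exact: n1.
apply/andP; split; rewrite lt_neqAle ?w2 ?w3 andbT; apply/eqP => // E; exact: n2.
Qed.

Lemma comparison_solutions u v :
  subsolution G A u -> supersolution G A v ->
  usc_within D u -> usc_within D (fun y => - v y) ->
  (forall w, D w -> ~ A w -> u w <= v w) -> forall w, D w -> u w <= v w.
Proof.
move=> subu supv uscu lscv bd; apply: (comparison m0 cG A0 A1 uscu lscv).
- exact: subsolution_quadratic subu.
- by apply: subsolution_quadratic => //; apply/mirror_subsolution.
- by move=> w Dw /(slab_not_Omega Dw); exact: bd.
Qed.

Variables um up : R * R -> R.
Hypothesis um_bounded : forall w, D w -> exists M, exists2 r : R, 0 < r &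
  forall y, D y -> box w r y -> - um y <= M.
Hypothesis up_bounded : forall w, D w -> exists M, exists2 r : R, 0 < r &
  forall y, D y -> box w r y -> up y <= M.
Hypotheses (subm : subsolution G A um) (supp : supersolution G A up).
Hypothesis umup : forall w, D w -> um w <= up w.
Hypothesis bd_eq : forall w, D w -> ~ A w -> um w = up w.
Hypothesis bd_up : forall w M, D w -> ~ A w -> up w < M ->
  \forall y \near w, D y -> up y < M.
Hypothesis bd_um : forall w M, D w -> ~ A w -> - um w < M ->
  \forall y \near w, D y -> - um y < M.

Lemma perron_existence : exists u, [/\ viscosity_solution G A u,
  usc_within D u, usc_within D (fun y => - u y) &
  forall w, D w -> um w <= u w <= up w].
Proof.
pose S := [set v | subsolution G A v /\ forall w, D w -> um w <= v w <= up w].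
have Sum : S um by split => // w Dw; rewrite lexx umup.
pose E w := [set v w | v in S].
have supE w : D w -> has_sup (E w).
  move=> Dw; split; first by exists (um w), um.
  by exists (up w) => _ [v [_ vb] <-]; have /andP[] := vb w Dw.
pose u0 w := sup (E w).
have u0up w : D w -> u0 w <= up w.
  move=> Dw; apply: ge_sup; first by have [] := supE w Dw.
  by move=> _ [v [_ vb] <-]; have /andP[] := vb w Dw.
have Su0 v w : S v -> D w -> v w <= u0 w.
  by move=> Sv Dw; apply: ub_le_sup; [have [] := supE w Dw|exists v].
have u0_bounded w : D w -> exists M, exists2 r : R, 0 < r &
    forall y, D y -> box w r y -> u0 y <= M.
  move=> /up_bounded[M [r r0 uM]]; exists M, r => // y Dy yr.
  exact: le_trans (u0up y Dy) (uM y Dy yr).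
pose U := usc_envelope D u0.
have uscU : usc_within D U := usc_envelope_usc u0_bounded.
have u0U w : D w -> u0 w <= U w := @le_usc_envelope _ _ _ u0_bounded w.
have AD : A `<=` D := Omega_sub_slab.
have subU : subsolution G A U.
  apply: (perron_sup cG oA (S := S)).
  - by move=> v [].
  - by move=> v y Sv /AD Dy; apply: le_trans (Su0 v y Sv Dy) (u0U y Dy).
  - exact: usc_within_subset uscU.
  - move=> w r e Aw r0 e0.
    have [d d0 dA] := nbhs_subbox (open_nbhs_nbhs (conj oA Aw)).
    have [|y [Dy yb yu]] :=
      @usc_envelope_approx _ _ _ u0_bounded w (Num.min r d) e (AD _ Aw) _ e0.
      by rewrite lt_min r0.
    have yr : box w r y by apply: box_subset yb; rewrite ge_min lexx.
    have yd : box w d y by apply: box_subset yb; rewrite ge_min lexx orbT.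
    have ye : 0 < u0 y - (U w - e) by rewrite subr_gt0.
    have [_ [v Sv <-]] := sup_adherent ye (supE y Dy).
    rewrite -/(u0 y) opprB addrC subrK => vy.
    by exists v, y; split => //; exact: dA.
(* At boundary points [up] inherits lower semicontinuity from [um], which lies below it and has the
   same value there. *)
have lscup : usc_within D (fun y => - up y).
  apply: (usc_within_open oA).
    apply/upper_semicontinuous_onP; rewrite /upper_semicontinuous_on.
    by under eq_fun do rewrite opprK; case: supp.
  move=> w M Dw nAw; rewrite -bd_eq// => /(bd_um Dw nAw).
  by apply: filterS => y umM Dy; have := umM Dy; have := umup Dy; lra.
(* Not immediate from [u0 <= up]: inside, [up] is only lower semicontinuous, so the upper envelope
   of [u0] could exceed it. Comparison is needed already here. *)
have Uup w : D w -> U w <= up w.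
  apply: (comparison_solutions subU supp uscU lscup) => y Dy nAy.
  apply: (usc_envelope_le u0_bounded Dy) => M /(bd_up Dy nAy) near_up.
  have [r r0 rM] := nbhs_subbox near_up; exists r => // z Dz zr.
  by apply: le_trans (u0up z Dz) (ltW (rM z zr Dz)).
have umU w : D w -> um w <= U w.
  by move=> Dw; apply: le_trans (Su0 um w Sum Dw) (u0U w Dw).
have SU : S U by split => // w Dw; rewrite umU ?Uup.
pose L w := - usc_envelope D (fun y => - U y) w.
have NU_bounded w : D w -> exists M, exists2 r : R, 0 < r &
    forall y, D y -> box w r y -> - U y <= M.
  move=> /um_bounded[M [r r0 uM]]; exists M, r => // y Dy yr.
  by have := uM y Dy yr; have := umU y Dy; lra.
have LU w : D w -> L w <= U w.
  by move=> Dw; rewrite /L lerNl; exact: le_usc_envelope NU_bounded _ Dw.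
have lscL : usc_within D (fun y => - L y).
  by rewrite /L; under eq_fun do rewrite opprK; exact: usc_envelope_usc.
have supL : supersolution G A L.
  apply: (perron_bump cG oA A0 subU supp).
  - by move=> y /AD; exact: LU.
  - by move=> y /AD Dy; apply: le_trans (LU y Dy) (Uup y Dy).
  - exact: usc_within_subset lscL.
  - move=> w r e Aw r0 e0.
    have [d d0 dA] := nbhs_subbox (open_nbhs_nbhs (conj oA Aw)).
    have [|y [Dy yb yu]] :=
      @usc_envelope_approx _ _ _ NU_bounded w (Num.min r d) e (AD _ Aw) _ e0.
      by rewrite lt_min r0.
    exists y; split; first by apply: dA; apply: box_subset yb; rewrite ge_min lexx orbT.
      by apply: box_subset yb; rewrite ge_min lexx.
    by rewrite /L; lra.
  - by move=> y /AD; exact: Uup.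
  (* Since [v] agrees with [U] off [A], it belongs to [S] and is bounded by the supremum. *)
  - move=> v subv vout vb y Ay.
    have Sv : S v.
      split => // w Dw; have [Aw|nAw] := pselect (A w).
        by have /andP[v1 v2] := vb w Aw; rewrite v2 andbT; apply: le_trans (umU w Dw) v1.
      by rewrite vout// umU ?Uup.
    by apply: le_trans (Su0 v y Sv (AD _ Ay)) (u0U y (AD _ Ay)).
(* On the boundary [U <= up = um <= L], the last inequality because [um] is lower semicontinuous
   there and lies below [U]. *)
have UL w : D w -> U w <= L w.
  apply: (comparison_solutions subU supL uscU lscL) => y Dy nAy.
  apply: le_trans (Uup y Dy) _; rewrite -bd_eq// /L lerNr.
  apply: (usc_envelope_le NU_bounded Dy) => M /(bd_um Dy nAy) near_um.
  have [r r0 rM] := nbhs_subbox near_um; exists r => // z Dz zr.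
  by have := rM z zr Dz; have := umU z Dz; lra.
have ULE w : D w -> L w = U w by move=> Dw; apply/eqP; rewrite eq_le LU ?UL.
exists U; split => //.
- split => //; apply: supersolution_eq_on supL => // y /AD; exact: ULE.
- move=> w M Dw; rewrite -ULE// => /(lscL _ _ Dw); apply: filterS => y LM Dy.
  by rewrite -ULE//; exact: LM.
- by move=> w Dw; rewrite umU ?Uup.
Qed.

End Existence.

(** * The parabolic domain *)

Section ParabolicDomain.
Context {R : realType}.
Implicit Types (T : \bar R) (m t : R) (u v : R * R -> R) (w y : R * R) (D : set (R * R)).

Lemma Omega_open T m : open (Omega T m).
Proof.
rewrite openE => w [w1 [wT /andP[w2 w3]]].
have [T' [wT' T'T]] := exists_real_between wT.
apply/near_box; exists (Num.min (Num.min w.1 (T' - w.1)) (Num.min w.2 (m - w.2))).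
  by rewrite !lt_min !subr_gt0 w1 w2 w3 wT'.
move=> y; rewrite !lt_min !ltr_norml.
move=> /andP[/andP[/andP[? ?] /andP[? ?]] _] /andP[_ /andP[/andP[? ?] /andP[? ?]]].
split; first by lra.
split; last by lra.
by apply: lt_trans T'T; rewrite lte_fin; lra.
Qed.

Lemma parabolic_boundaryE T m w : 0 < m ->
  parabolic_boundary T m w <-> slab T m w /\ ~ Omega T m w.
Proof.
move=> m0; have oO := @Omega_open T m.
rewrite /parabolic_boundary /topological_boundary /setD /= ((interior_id _).1 oO).
split.
  move=> [[cl nO] ntop]; split => //.
  have meets r : 0 < r -> exists2 y, Omega T m y & box w r y.
    by move=> r0; have [y [Oy yr]] := cl _ (nbhs_box w r0); exists y.
  have w1 : 0 <= w.1.
    rewrite leNgt; apply/negP => w1; have [|y [y1 _] [yr _]] := meets (- w.1); first by lra.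
    by move: yr; rewrite ltr_norml => /andP[? ?]; lra.
  have w2 : 0 <= w.2 <= m.
    apply/andP; split; rewrite leNgt; apply/negP => w2.
      have [|y [_ [_ y2]] [_ yr]] := meets (- w.2); first by lra.
      by move: yr y2; rewrite ltr_norml => /andP[? ?] /andP[? ?]; lra.
    have [|y [_ [_ y2]] [_ yr]] := meets (w.2 - m); first by lra.
    by move: yr y2; rewrite ltr_norml => /andP[? ?] /andP[? ?]; lra.
  split => //; split => //.
  rewrite lt_neqAle; apply/andP; split; first by apply/eqP => E; exact: ntop.
  rewrite leNgt; apply/negP => Tw.
  case: T cl nO ntop oO meets Tw => [r| |] //; last first.
    move=> _ _ _ _ meets _; have [y [_ [+ _]] _] := meets 1 ltr01.
    by rewrite ltNge leNye.
  move=> _ _ _ _ meets; rewrite lte_fin => rw.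
  have [|y [_ [+ _]] [yr _]] := meets (w.1 - r); first by lra.
  by rewrite lte_fin => ?; move: yr; rewrite ltr_norml => /andP[? ?]; lra.
move=> [[w1 [wT w2]] nO]; split; last first.
  by move=> [E _]; move: wT; rewrite E ltxx.
split => // B /nbhs_subbox[r r0 rB].
have [T' [wT' T'T]] := exists_real_between wT.
pose M := `|T' - w.1| + `|m / 2 - w.2| + 1.
have M0 : 0 < M.
  by have := normr_ge0 (T' - w.1); have := normr_ge0 (m / 2 - w.2); rewrite /M; lra.
(* The fraction moved from [w] towards the point [(T', m / 2)] of the open strip: strictly between 0
   and 1, and small enough to stay in the box since [M] exceeds both coordinate distances. *)
pose l := Num.min (1 / 2) (r / M).
have l0 : 0 < l by rewrite lt_min !divr_gt0.
have l1 : l < 1 by rewrite gt_min; apply/orP; left; lra.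
have lM : l * M <= r by rewrite -ler_pdivlMr// ge_min lexx orbT.
exists (w.1 + l * (T' - w.1), w.2 + l * (m / 2 - w.2)); split; last first.
  apply: rB; split => /=; rewrite addrC addKr normrM gtr0_norm//;
    apply: lt_le_trans lM; rewrite ltr_pM2l// /M.
    by have := normr_ge0 (m / 2 - w.2); lra.
  by have := normr_ge0 (T' - w.1); lra.
have /andP[w20 w2m] := w2.
split => /=.
  by have : 0 < l * (T' - w.1) by [rewrite mulr_gt0// subr_gt0]; lra.
split; last by apply/andP; split; nra.
by apply: lt_trans T'T; rewrite lte_fin; nra.
Qed.

Lemma Omega_barE T m : 0 < m -> Omega_bar T m = slab T m.
Proof.
move=> m0; apply/seteqP; split => w.
  by move=> [/Omega_sub_slab|/(parabolic_boundaryE _ _ m0)[]].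
move=> Dw; have [Ow|nOw] := pselect (Omega T m w); first by left.
by right; apply/parabolic_boundaryE.
Qed.

Lemma locally_bounded_box D u w : [locally [bounded u w | w in D]] -> D w ->
  exists M : R, exists2 r : R, 0 < r & forall y, D y -> box w r y -> `|u y| <= M.
Proof.
move=> bu Dw; have [M [_ /(_ (M + 1))]] := bu w Dw.
rewrite ltrDl ltr01 => /(_ isT) near_u.
have [r r0 rM] := nbhs_subbox near_u.
by exists (M + 1), r => // y Dy yr; exact: rM.
Qed.

Let shrink D w (r : R) := [set y : R * R | D y /\ `|y - w| <= r].

Let box_shrink D w (r : R) y : D y -> box w r y -> shrink D w r y.
Proof. by move=> Dy [y1 y2]; split => //; rewrite prod_normE /= ge_max !ltW. Qed.

(** The supremum is monotone in [r], so the limit exists in the extended reals and is an infimum. *)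
Lemma upper_envelopeE D u w : upper_envelope D u w =
  ereal_inf [set ereal_sup [set (u y)%:E | y in shrink D w r] | r in `]0%R, +oo[].
Proof.
apply: cvg_lim => //; apply: (nondecreasing_at_right_cvge (BInfty _ false)) => //.
move=> r s _ _ rs; apply: ereal_sup_le => _ [y [Dy yr] <-]; exists y => //.
by split => //; exact: le_trans rs.
Qed.

Lemma lower_envelopeE D u w : lower_envelope D u w =
  ereal_sup [set ereal_inf [set (u y)%:E | y in shrink D w r] | r in `]0%R, +oo[].
Proof.
apply: cvg_lim => //; apply: (nonincreasing_at_right_cvge (BInfty _ false)) => //.
move=> r s _ _ rs; apply: ereal_inf_le_tmp => _ [y [Dy yr] <-]; exists y => //.
by split => //; exact: le_trans rs.
Qed.

Lemma le_upper_envelope D u w : D w -> ((u w)%:E <= upper_envelope D u w)%E.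
Proof.
move=> Dw; rewrite upper_envelopeE; apply: le_ereal_inf_tmp => _ [r /= + <-].
rewrite in_itv /= andbT => r0; apply: ereal_sup_ubound; exists w => //.
by split => //; rewrite subrr normr0 ltW.
Qed.

Lemma ge_lower_envelope D u w : D w -> (lower_envelope D u w <= (u w)%:E)%E.
Proof.
move=> Dw; rewrite lower_envelopeE; apply: ge_ereal_sup => _ [r /= + <-].
rewrite in_itv /= andbT => r0; apply: ereal_inf_lbound; exists w => //.
by split => //; rewrite subrr normr0 ltW.
Qed.

Lemma upper_envelope_lt D u w (M : R) : (upper_envelope D u w < M%:E)%E ->
  \forall y \near w, D y -> u y < M.
Proof.
rewrite upper_envelopeE => /ereal_inf_lt[_ [r + <-] supM].
rewrite /= in_itv /= andbT => r0.
apply: filterS (nbhs_box w r0) => y yr Dy; rewrite -lte_fin; apply: le_lt_trans supM.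
by apply: ereal_sup_ubound; exists y => //; exact: box_shrink.
Qed.

Lemma lower_envelope_gt D u w (M : R) : (M%:E < lower_envelope D u w)%E ->
  \forall y \near w, D y -> M < u y.
Proof.
rewrite lower_envelopeE => /ereal_sup_gt[_ [r + <-] infM].
rewrite /= in_itv /= andbT => r0.
apply: filterS (nbhs_box w r0) => y yr Dy; rewrite -lte_fin; apply: lt_le_trans infM _.
by apply: ereal_inf_lbound; exists y => //; exact: box_shrink.
Qed.

Lemma x_monotonic_solution (G : R * R * R * R -> R) T m u um up :
  0 < m -> continuous G -> cond_A0 G -> cond_A1 G ->
  viscosity_solution G (Omega T m) u -> {within slab T m, continuous u} ->
  (forall w, slab T m w -> um w <= u w <= up w) ->
  (forall w, slab T m w -> ~ Omega T m w -> um w = up w) ->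
  x_monotonic (slab T m) um -> x_monotonic (slab T m) up ->
  x_monotonic (slab T m) u.
Proof.
move=> m0 cG A0 A1 [subu supu] cu ub bd mono_m mono_p.
have oO := @Omega_open T m.
have uscu := continuous_within_usc cu; have lscu := continuous_within_lsc cu.
have bd_um w : slab T m w -> ~ Omega T m w -> u w = um w.
  move=> Dw nOw; have /andP[h1 h2] := ub w Dw.
  by apply/eqP; rewrite eq_le h1 (bd w Dw nOw) h2.
have low (t x y : R) : slab T m (t, x) -> slab T m (t, y) -> x <= y ->
    ~ Omega T m (t, x) -> u (t, x) <= u (t, y).
  move=> Dx Dy xy nO; rewrite bd_um//; apply: le_trans (mono_m _ _ _ Dx Dy xy) _.
  by have /andP[] := ub _ Dy.
have high (t x y : R) : slab T m (t, x) -> slab T m (t, y) -> x <= y ->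
    ~ Omega T m (t, y) -> u (t, x) <= u (t, y).
  move=> Dx Dy xy nO; rewrite (bd_um _ Dy nO) (bd _ Dy nO).
  apply: le_trans (mono_p _ _ _ Dx Dy xy).
  by have /andP[] := ub _ Dx.
move=> t x y Dx Dy xy.
(* With both points inside, [0 < x] and [y < m] make the narrower width [m - h] positive. *)
have [Ox|] := pselect (Omega T m (t, x)); last exact: low.
have [Oy|] := pselect (Omega T m (t, y)); last exact: high.
have [_ [_ /= /andP[x0 _]]] := Ox; have [t0 [tT /= /andP[_ ym]]] := Oy.
pose h := y - x; have h0 : 0 <= h by rewrite subr_ge0.
have mh : m - h <= m by rewrite gerBl.
have sub_slab w : slab T (m - h) w -> slab T m w.
  by move=> [w1 [wT /andP[w2 w3]]]; do 2?split => //; rewrite w2 (le_trans w3).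
have shift_slab w : slab T (m - h) w -> slab T m (w.1, w.2 + h).
  by move=> [w1 [wT /andP[w2 w3]]]; do 2?split => //=; lra.
pose v w := u (w.1, w.2 + h).
have -> : u (t, y) = v (t, x) by rewrite /v /h /= addrC subrK.
apply: (@comparison _ G T (m - h) u v _ cG A0 A1).
- by rewrite /h; lra.
- by apply: usc_within_subset uscu => w; exact: sub_slab.
- move=> w M Dw vM; have := lscu _ M (shift_slab w Dw) vM.
  move=> /nbhs_subbox[r r0 rM]; apply: filterS (nbhs_box w r0) => z [z1 z2] Dz.
  apply: (rM (z.1, z.2 + h)); last exact: shift_slab.
  by split => //=; rewrite opprD addrACA subrr addr0.
- move=> s z [s0 [sT /andP[z0 z1]]]; apply: (subsolution_quadratic oO subu).
  by split => //; split => //; rewrite z0 (lt_le_trans z1).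
- have subNu := (mirror_subsolution G u oO).1 supu.
  move=> s z [s0 [sT /andP[z0 z1]]] a b p q r r0 touch.
  apply: (subsolution_quadratic oO subNu _ r0 (b := b)) => /=.
    by split => //; split => //=; rewrite /= in z0 z1; lra.
  by move=> k l kr lr; have := touch k l kr lr; rewrite /v /= (addrAC z l).
- move=> [s z] Dz zb; have zh : z <= z + h by rewrite lerDl.
  (* At [s = 0] or [z = 0] the left point is on the parabolic boundary, where [u = um]; at
     [z = m - h] the translated point is, where [u = up]. *)
  have [E|E] : (s = 0 \/ z = 0) \/ z = m - h by move: zb => /= [->|[->|->]]; tauto.
    apply: low => //; [exact: sub_slab|exact: (shift_slab (s, z))|].
    by apply/slab_not_Omega; [exact: sub_slab|move: E => /= [->|->]; tauto].
  apply: high => //; [exact: sub_slab|exact: (shift_slab (s, z))|].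
  apply/slab_not_Omega; first exact: (shift_slab (s, z)).
  by rewrite /= E subrK; tauto.
- by split; [exact: ltW|split => //=; rewrite ltW//= /h; lra].
Qed.

End ParabolicDomain.

(** * Uniqueness and existence on the parabolic domain *)

Section UniqueSolution.
Context {R : realType}.
Variables (T : \bar R) (m : R) (G : R * R * R * R -> R).
Hypotheses (m0 : 0 < m) (cG : continuous G) (A0 : cond_A0 G) (A1 : cond_A1 G).
Implicit Types (u v um up : R * R -> R).

Lemma solution_unique u v :
  viscosity_solution G (Omega T m) u -> viscosity_solution G (Omega T m) v ->
  {within slab T m, continuous u} -> {within slab T m, continuous v} ->
  (forall w, parabolic_boundary T m w -> v w = u w) ->
  forall w, slab T m w -> v w = u w.
Proof.
move=> [subu supu] [subv supv] cu cv bd w Dw.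
have oO := @Omega_open R T m.
have bd' y : slab T m y -> ~ Omega T m y -> v y = u y.
  by move=> Dy nOy; apply: bd; apply/parabolic_boundaryE.
apply/eqP; rewrite eq_le; apply/andP; split.
  apply: (comparison_solutions m0 cG A0 A1 oO subv supu) Dw.
  - exact: continuous_within_usc.
  - exact: continuous_within_lsc.
  - by move=> y Dy nOy; rewrite bd'.
apply: (comparison_solutions m0 cG A0 A1 oO subu supv) Dw.
- exact: continuous_within_usc.
- exact: continuous_within_lsc.
- by move=> y Dy nOy; rewrite bd'.
Qed.

Lemma solution_between um up :
  [locally [bounded um w | w in slab T m]] ->
  [locally [bounded up w | w in slab T m]] ->
  subsolution G (Omega T m) um -> supersolution G (Omega T m) up ->
  (forall w, slab T m w -> um w <= up w) ->
  (forall w, parabolic_boundary T m w ->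
     lower_envelope (slab T m) um w = upper_envelope (slab T m) up w) ->
  (forall w, parabolic_boundary T m w -> um w = up w) /\
  exists u, [/\ viscosity_solution G (Omega T m) u, {within slab T m, continuous u},
    forall w, parabolic_boundary T m w -> u w = um w &
    forall w, slab T m w -> um w <= u w <= up w].
Proof.
move=> bum bup subm supp umup env.
have oO := @Omega_open R T m.
have pbP w : slab T m w -> ~ Omega T m w -> parabolic_boundary T m w.
  by move=> Dw nOw; apply/parabolic_boundaryE.
(* In the chain lower envelope of [um], [um], [up], upper envelope of [up], each term is at most the
   next, and by (B2) the two ends agree. *)
have env_m w : parabolic_boundary T m w -> lower_envelope (slab T m) um w = (um w)%:E.
  move=> bw; have [Dw _] := (parabolic_boundaryE T w m0).1 bw.
  apply/eqP; rewrite eq_le ge_lower_envelope//= env//.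
  by rewrite (le_trans _ (le_upper_envelope up Dw))// lee_fin umup.
have env_p w : parabolic_boundary T m w -> upper_envelope (slab T m) up w = (up w)%:E.
  move=> bw; have [Dw _] := (parabolic_boundaryE T w m0).1 bw.
  apply/eqP; rewrite eq_le le_upper_envelope// andbT -env//.
  by rewrite (le_trans (ge_lower_envelope um Dw))// lee_fin umup.
have eq_mp w : parabolic_boundary T m w -> um w = up w.
  by move=> bw; have := env w bw; rewrite env_m// env_p// => -[].
split=> //.
have [|||||u [solu uscu lscu ub]] :=
    @perron_existence R G T m m0 cG A0 A1 oO um up _ _ subm supp umup.
- move=> w /(locally_bounded_box bum)[M [r r0 rM]]; exists M, r => // y Dy yr.
  by apply: le_trans (rM y Dy yr); rewrite -normrN ler_norm.
- move=> w /(locally_bounded_box bup)[M [r r0 rM]]; exists M, r => // y Dy yr.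
  by apply: le_trans (rM y Dy yr); rewrite ler_norm.
- by move=> w Dw nOw; apply: eq_mp; exact: pbP.
- move=> w M Dw nOw upM; apply: upper_envelope_lt.
  by rewrite env_p ?lte_fin//; exact: pbP.
- move=> w M Dw nOw umM.
  have : (((- M)%:E) < lower_envelope (slab T m) um w)%E.
    by rewrite env_m ?lte_fin 1?ltrNl//; exact: pbP.
  by move=> /lower_envelope_gt; apply: filterS => y umy Dy; rewrite ltrNl; exact: umy.
exists u; split => //; first exact: usc_within_continuous_within.
move=> w bw; have [Dw _] := (parabolic_boundaryE T w m0).1 bw.
have /andP[h1 h2] := ub w Dw.
by apply/eqP; rewrite eq_le h1 (eq_mp w bw) h2.
Qed.

End UniqueSolution.

Theorem theorem2p14 (R : realType) (T : \bar R) (m : R)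
    (G : R * R * R * R -> R) :
  (0 < T)%E -> 0 < m -> continuous G -> cond_A0 G -> cond_A1 G ->
  (forall um up : R * R -> R,
     [locally [bounded um w | w in Omega_bar T m]] ->
     [locally [bounded up w | w in Omega_bar T m]] ->
     x_monotonic (Omega_bar T m) um ->
     x_monotonic (Omega_bar T m) up ->
     subsolution G (Omega T m) um ->
     supersolution G (Omega T m) up ->
     (forall w, Omega_bar T m w -> um w <= up w) ->
     (forall w, parabolic_boundary T m w ->
        lower_envelope (Omega_bar T m) um w =
        upper_envelope (Omega_bar T m) up w) ->
     (forall w, parabolic_boundary T m w -> um w = up w) /\
     exists u : R * R -> R,
       [/\ [/\ x_monotonic (Omega_bar T m) u,
               viscosity_solution G (Omega T m) u,
               {within Omega_bar T m, continuous u} &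
               forall w, parabolic_boundary T m w -> u w = um w],
           forall v : R * R -> R,
             [/\ x_monotonic (Omega_bar T m) v,
                 viscosity_solution G (Omega T m) v,
                 {within Omega_bar T m, continuous v} &
                 forall w, parabolic_boundary T m w -> v w = um w] ->
             forall w, Omega_bar T m w -> v w = u w &
           forall w, Omega_bar T m w -> um w <= u w <= up w]) /\
  (forall um up : R * R -> R,
     [locally [bounded um w | w in Omega_bar T m]] ->
     [locally [bounded up w | w in Omega_bar T m]] ->
     subsolution G (Omega T m) um ->
     supersolution G (Omega T m) up ->
     (forall w, Omega_bar T m w -> um w <= up w) ->
     (forall w, parabolic_boundary T m w ->
        lower_envelope (Omega_bar T m) um w =
        upper_envelope (Omega_bar T m) up w) ->
     (forall w, parabolic_boundary T m w -> um w = up w) /\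
     exists u : R * R -> R,
       [/\ [/\ viscosity_solution G (Omega T m) u,
               {within Omega_bar T m, continuous u} &
               forall w, parabolic_boundary T m w -> u w = um w],
           forall v : R * R -> R,
             [/\ viscosity_solution G (Omega T m) v,
                 {within Omega_bar T m, continuous v} &
                 forall w, parabolic_boundary T m w -> v w = um w] ->
             forall w, Omega_bar T m w -> v w = u w &
           forall w, Omega_bar T m w -> um w <= u w <= up w]).
Proof.
move=> _ m0 cG A0 A1; rewrite Omega_barE//; split.
  move=> um up bum bup mono_m mono_p subm supp umup env.
  have [eq_mp [u [solu cu bu ub]]] :=
    solution_between m0 cG A0 A1 bum bup subm supp umup env.
  split => //; exists u; split => //; first split => //.
    apply: (x_monotonic_solution m0 cG A0 A1 solu cu ub _ mono_m mono_p).
    by move=> w Dw nOw; apply: eq_mp; apply/parabolic_boundaryE.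
  move=> v [_ solv cv bv]; apply: (solution_unique m0 cG A0 A1 solu solv cu cv).
  by move=> w bw; rewrite bv// bu.
move=> um up bum bup subm supp umup env.
have [eq_mp [u [solu cu bu ub]]] :=
  solution_between m0 cG A0 A1 bum bup subm supp umup env.
split => //; exists u; split => // v [solv cv bv].
apply: (solution_unique m0 cG A0 A1 solu solv cu cv).
by move=> w bw; rewrite bv// bu.
Qed.
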